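(* The complex cubic fields whose shape lies on the boundary of the Gauss fundamental domain $\mathcal{G}=\{x+iy:0\le x\le\frac12,\ x^2+y^2\ge1\}$ are exactly the wild pure cubic fields.
   Context: A complex cubic field $K$ has one real and two complex embeddings $\sigma_1,\sigma_2,\sigma_3$. With $\alpha^\perp:=3\alpha-\mathrm{Tr}_{K/\mathbf{Q}}(\alpha)$ and $1,\alpha_1,\alpha_2$ a $\mathbf{Z}$-basis of $\mathcal{O}_K$, let $M(x,y)=\sum_i|\sigma_i(x\alpha_1^\perp+y\alpha_2^\perp)|^2=rx^2+sxy+ty^2$ and $z(M)=\frac{s}{2r}+i\frac{\sqrt{4rt-s^2}}{2r}$. The shape $\mathrm{sh}(K)$ is the unique point of $\mathcal{G}$ in the $\mathrm{GL}_2(\mathbf{Z})$-orbit of $z(M)$ (with $g$ acting by $z\mapsto\frac{az+b}{cz+d}$ if $\det g=1$, $z\mapsto\frac{a\bar z+b}{c\bar z+d}$ if $\det g=-1$). A pure cubic field is one isomorphic to $\mathbf{Q}(\sqrt[3]{m})$, $m\in\mathbf{Q}$ a non-cube; it is wild if $3$ is wildly (i.e. totally, $3\mathcal{O}_K=\mathfrak{p}^3$) ramified in it. *)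

(* Defs.v *)
From HB Require Import structures.
From mathcomp Require Import all_boot all_order all_algebra all_field.
From mathcomp Require Import complex.
From mathcomp Require Import all_classical all_reals all_analysis.

Set Implicit Arguments.
Unset Strict Implicit.
Unset Printing Implicit Defensive.

Import Order.TTheory GRing.Theory Num.Theory.
Import numFieldNormedType.Exports.

Local Open Scope classical_set_scope.
Local Open Scope card_scope.
Local Open Scope ring_scope.

Definition boundary (T : topologicalType) (A : set T) : set T :=
  closure A `\` interior A.

Section NumberField.
Variable K : fieldExtType rat.

Definition ring_of_integers : set K :=
  [set x | integralOver (intr : int -> K) x].

Definition is_integral_basis (a1 a2 : K) : Prop :=
  (forall x : K, ring_of_integers x <->
     exists c0 c1 c2 : int, x = c0%:~R + a1 *~ c1 + a2 *~ c2) /\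
  (forall c0 c1 c2 : int, c0%:~R + a1 *~ c1 + a2 *~ c2 = 0 ->
     [/\ c0 = 0, c1 = 0 & c2 = 0]).

(* The trace of multiplication by a on the rat-vector space K; galTrace is    *)
(* not usable here, as it sums over automorphisms and a complex cubic field   *)
(* is not normal.                                                             *)
Definition field_trace (a : K) : rat :=
  \tr (passmx.mxof (vbasis {:K}) (vbasis {:K}) (amull a)).

Definition perp (a : K) : K := 3%:R * a - (field_trace a)%:A.

Definition is_ideal (I : set K) : Prop :=
  [/\ I `<=` ring_of_integers, I 0,
      forall x y, I x -> I y -> I (x + y) &
      forall a x, ring_of_integers a -> I x -> I (a * x)].

Definition is_prime_ideal (P : set K) : Prop :=
  [/\ is_ideal P, ~ P 1 &
      forall x y, ring_of_integers x -> ring_of_integers y ->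
        P (x * y) -> P x \/ P y].

Definition ideal_mul (I J : set K) : set K :=
  [set x | exists n (u v : 'I_n -> K),
     (forall i, I (u i) /\ J (v i)) /\ x = \sum_(i < n) u i * v i].

Definition wildly_ramified_at_3 : Prop :=
  exists P : set K, is_prime_ideal P /\
    [set 3%:R * x | x in ring_of_integers] = ideal_mul (ideal_mul P P) P.

(* K is isomorphic to Q(m^(1/3)) iff it is generated over Q by an element     *)
(* whose cube is m (the image of the cube root under the isomorphism).        *)
Definition is_pure_cubic : Prop :=
  exists m : rat, (forall q : rat, q ^+ 3 <> m) /\
    exists a : K, a ^+ 3 = m%:A /\ <<1; a>>%VS = {:K}%VS.

Definition is_wild_pure_cubic : Prop := is_pure_cubic /\ wildly_ramified_at_3.

End NumberField.

Section Shape.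
Variable R : realType.

(* Im z > 0 makes explicit that the domain lies in the upper half-plane.      *)
(* The ascription selects the norm topology of R[i].                          *)
Definition gauss_domain : set (R[i] : numFieldType) :=
  [set z | [/\ 0 < complex.Im z, 0 <= complex.Re z <= 2^-1 &
               1 <= complex.Re z ^+ 2 + complex.Im z ^+ 2]].

Definition GL2Z_act (g : 'M[int]_2) (z : R[i]) : R[i] :=
  let w := if \det g == 1 then z else conjc z in
  ((g 0 0)%:~R * w + (g 0 1)%:~R) / ((g 1 0)%:~R * w + (g 1 1)%:~R).

Definition form_root (r s t : R) : R[i] :=
  Complex (s / (2 * r)) (Num.sqrt (4 * r * t - s ^+ 2) / (2 * r)).

Variable K : fieldExtType rat.

Definition embeddings : set (K -> R[i]) :=
  [set f : K -> R[i] |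
     exists phi : {rmorphism K -> R[i]}, f = phi :> (K -> R[i])].

Definition real_valued : set (K -> R[i]) :=
  [set f | forall x, complex.Im (f x) = 0].

Definition is_complex_cubic : Prop :=
  [/\ \dim {:K} = 3%N,
      embeddings `&` real_valued #= `I_1 &
      embeddings `\` real_valued #= `I_2].

Definition minkowski_form (a1 a2 : K) (x y : int) : R :=
  \sum_(f \in embeddings)
    Normc.normc (f (perp a1 *~ x + perp a2 *~ y)) ^+ 2.

Definition shape_points : set R[i] :=
  [set z | gauss_domain z /\
     exists (a1 a2 : K) (r s t : R),
       [/\ is_integral_basis a1 a2,
           forall x y : int, minkowski_form a1 a2 x y =
             r * x%:~R ^+ 2 + s * x%:~R * y%:~R + t * y%:~R ^+ 2 &
           exists2 g : 'M[int]_2,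
             g \in unitmx & z = GL2Z_act g (form_root r s t)]].

(* shape_points is a singleton for a complex cubic field; the value 0         *)
(* returned on an empty set is outside gauss_domain and its boundary.         *)
Definition field_shape : R[i] := xget 0 shape_points.

End Shape.

(* Main.v *)
Require Import Defs.
From HB Require Import structures.
From mathcomp Require Import all_boot all_order all_algebra all_field.
From mathcomp Require Import complex.
From mathcomp Require Import all_classical all_reals all_analysis.
From mathcomp Require Import ring lra zify.

(** Let f be the real embedding of a complex cubic field K.  On elements of trace
    zero the form is M(w) = 3 f(w)^2 - Tr(w^2), so M(x + y) = M(x - y) holds exactly
    when x y is rational.  A reduced basis whose shape lies on the boundary of the
    Gauss domain yields such x, y spanning a sublattice of index at most 2 of the
    perps of the integers; since Tr x = Tr y = 0 and x y is rational, x^3 is rational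
    and K is pure.

    Let al, be be the cube roots of m = a b^2 and of a^2 b, with a, b squarefree and
    coprime.  A norm computation gives 3 O <= Z[al, be].  If 3 | a b or m is not +-1
    mod 9, then O = Z[al, be] and 3 O = (al - m, 3)^3 (up to exchanging a and b).
    Otherwise e = (1 + m al + (m al)^2) / 3 is an integer which is idempotent modulo
    nilpotents in O / 3 O, so 3 is not totally ramified, and the perps of the integers
    contain perp e but meet each axis in multiples of 3, which excludes x and y.

    Conversely, when O = Z[al, be], the form is diagonal in al, be, and a diagonal
    form has no reduced basis in the interior of the Gauss domain. *)

Set Implicit Arguments.
Unset Strict Implicit.
Unset Printing Implicit Defensive.
Import Order.TTheory GRing.Theory Num.Theory.
Import numFieldNormedType.Exports.
Local Open Scope classical_set_scope.
Local Open Scope ring_scope.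

(** * Cube-free integers and integral rationals *)

(** For z = X + iY the form is proportional to |x + z y|^2, so each boundary condition is an
    orthogonality: X = 0 makes a1, a2 orthogonal, X = 1/2 makes 2 a2 - a1, a1 orthogonal, and |z| =
    1 makes a1 + a2, a1 - a2 orthogonal. The last two pairs only span a sublattice of index 2; this
    is harmless because every later obstruction is a divisibility by 3. [field_shape] is a choice
    from [shape_points], so both directions argue about an arbitrary point of that set and must
    settle separately the empty case, where the value is 0. Integers of a pure field are located by
    the elementary symmetric functions of the conjugates: traces bound the denominators of the
    coordinates by 3 a b, the norm lowers this to 3, and the last factor 3 is a congruence problem
    modulo 3. *)

Definition squarefree (n : nat) := forall h : nat, (h ^ 2 %| n)%N -> h = 1%N.

(** Write a = a' g and c = c' g with g = gcd(a, c). Then a' is prime to c', and to g since a is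
    squarefree; as a' divides (c' g)^3, it is 1. *)
Lemma squarefree_dvdn_cube (a c : nat) :
  squarefree a -> (a %| c ^ 3)%N -> (a %| c)%N.
Proof.
move=> sqa.
have [->|c0] := eqVneq c 0%N; first by rewrite dvdn0.
have g0 : (0 < gcdn a c)%N by rewrite gcdn_gt0 !lt0n c0 orbT.
have [a' ea] := dvdnP (dvdn_gcdl a c).
have [c' ec] := dvdnP (dvdn_gcdr a c).
have cop : coprime a' c'.
  rewrite /coprime -(eqn_pmul2r g0) mul1n muln_gcdl -ea -ec eqxx //.
have copg : coprime a' (gcdn a c).
  rewrite /coprime; apply/eqP/sqa; rewrite [X in (_ %| X)%N]ea -mulnn.
  by apply: dvdn_mul; [apply: dvdn_gcdl|apply: dvdn_gcdr].
move=> ac3.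
have h : (a' %| c' ^ 3 * gcdn a c ^ 3)%N.
  rewrite -expnMn -ec; apply: dvdn_trans ac3.
  by rewrite [X in (_ %| X)%N]ea dvdn_mulr.
have : (a' %| gcdn a c ^ 3)%N by rewrite -(Gauss_dvdr _ (coprimeXr 3 cop)).
rewrite -[X in (_ %| X)%N]muln1 Gauss_dvdr ?coprimeXr// dvdn1 => /eqP a1.
by rewrite ea a1 mul1n dvdn_gcdr.
Qed.

(** Take b maximal with b^2 dividing N and a = N / b^2. A square factor of a would enlarge b; a
    square factor of b, or a common factor of a and b, would put a cube into N. *)
Lemma cubefree_split (N : nat) :
  (0 < N)%N -> (forall h : nat, (h ^ 3 %| N)%N -> h = 1%N) ->
  exists a b : nat, [/\ (0 < a)%N, (0 < b)%N & N = (a * b ^ 2)%N] /\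
    [/\ squarefree a, squarefree b & coprime a b].
Proof.
move=> N0 cfN.
have exb : exists b, (b ^ 2 %| N)%N by exists 1%N; rewrite exp1n dvd1n.
have leb b : (b ^ 2 %| N)%N -> (b <= N)%N.
  by move=> /(dvdn_leq N0); apply: leq_trans; rewrite -mulnn; case: b => // b; nia.
case: (ex_maxnP exb leb) => b /dvdnP[a eN] maxb.
have b0 : (0 < b)%N by rewrite lt0n; apply: contraTneq N0 => b0; rewrite eN b0 exp0n// muln0.
have a0 : (0 < a)%N by rewrite lt0n; apply: contraTneq N0 => a0; rewrite eN a0 mul0n.
exists a, b; split=> //; split.
- move=> h /dvdnP[k ek].
  have := maxb (h * b)%N; rewrite eN ek.
  have -> : ((h * b) ^ 2 %| k * h ^ 2 * b ^ 2)%N by rewrite expnMn -mulnA dvdn_mull.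
  move=> /(_ isT) le.
  have : h != 0%N by apply: contraTneq a0 => h0; rewrite ek h0 muln0.
  by nia.
- move=> h /dvdnP[k ek]; apply: cfN; rewrite eN ek expnMn -expnM mulnA.
  by rewrite dvdn_mull// dvdn_exp2l.
- apply/eqP/cfN; rewrite eN (expnS _ 2).
  by apply: dvdn_mul; rewrite ?dvdn_gcdl// dvdn_exp2r// dvdn_gcdr.
Qed.

Lemma int_of_integral_rat (F : numFieldType) (phi : {rmorphism rat -> F}) (q : rat) :
  integralOver (intr : int -> F) (phi q) -> exists n : int, q = n%:~R.
Proof.
move=> [p mp rp].
have rq : root (map_poly (intr : int -> rat) p) q.
  rewrite -(fmorph_root phi) -map_poly_comp.
  rewrite (eq_map_poly (g := intr : int -> F))//.
  by move=> x /=; rewrite rmorph_int.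
have : (ratr q : algC) \in Num.int.
  apply: Cint_rat_Aint; first exact: Crat_rat.
  apply: (@root_monic_Aint (map_poly (intr : int -> algC) p)).
  - have -> : map_poly (intr : int -> algC) p =
      map_poly (ratr : rat -> algC) (map_poly (intr : int -> rat) p).
      by rewrite -map_poly_comp; apply: eq_map_poly => x /=; rewrite rmorph_int.
    by rewrite fmorph_root.
  - by rewrite monic_map.
  - by apply/polyOverP => i; rewrite coef_map rpred_int.
move=> /intrP[n en]; exists n.
by apply: (fmorph_inj (ratr : {rmorphism rat -> algC})); rewrite /= en rmorph_int.
Qed.

(** * Pure cubic fields *)

Definition comb3 (K : fieldExtType rat) (u v : K) (x0 x1 x2 : rat) : K :=
  in_alg K x0 + in_alg K x1 * u + in_alg K x2 * v.

Definition basis3 (K : fieldExtType rat) (u v : K) : Prop :=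
  (forall x, exists x0 x1 x2, x = comb3 u v x0 x1 x2) /\
  (forall x0 x1 x2, comb3 u v x0 x1 x2 = 0 -> [/\ x0 = 0, x1 = 0 & x2 = 0]).

(** A cubic without rational root is irreducible, so reduction modulo X^3 - m gives spanning, and a
    Bezout relation with X^3 - m gives freeness. *)
Lemma cube_root_basis (K : fieldExtType rat) (m : rat) (a : K) :
  (forall q : rat, q ^+ 3 <> m) -> a ^+ 3 = m%:A -> <<1; a>>%VS = {:K}%VS ->
  basis3 a (a ^+ 2).
Proof.
move=> ncube a3 gen.
pose p : {poly rat} := 'X^3 - m%:P.
have sp : size p = 4%N by rewrite size_XnsubC.
have p0 : p != 0 by rewrite -size_poly_eq0 sp.
have irr : irreducible_poly p.
  apply: cubic_irreducible; first by rewrite sp.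
  move=> x; apply/negP; rewrite /root !hornerE subr_eq0 => /eqP.
  exact: ncube.
have pa : (map_poly (in_alg K) p).[a] = 0.
  by rewrite rmorphB /= map_polyXn map_polyC /= !hornerE a3 subrr.
have ev (q : {poly rat}) : (size q <= 3)%N ->
    (map_poly (in_alg K) q).[a] = comb3 a (a ^+ 2) q`_0 q`_1 q`_2.
  move=> sq; rewrite (horner_coef_wide (n := 3)) ?size_map_poly//.
  by rewrite !big_ord_recr big_ord0 /= !coef_map /= add0r expr0 mulr1 expr1.
split=> [x|x0 x1 x2].
  have : x \in <<1; a>>%VS by rewrite gen memvf.
  case/Fadjoin_polyP => r /polyOver1P[q ->] ->.
  have e : (map_poly (in_alg K) q).[a] = (map_poly (in_alg K) (q %% p)).[a].
    by rewrite {1}(divp_eq q p) rmorphD rmorphM /= !hornerE pa mulr0 add0r.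
  by rewrite e ev; [do 3 eexists|rewrite -ltnS -sp ltn_modp].
pose q := Poly [:: x0; x1; x2].
have sq : (size q <= 3)%N by apply: leq_trans (size_Poly _) _.
have -> : comb3 a (a ^+ 2) x0 x1 x2 = (map_poly (in_alg K) q).[a].
  by rewrite ev// !coef_Poly.
move=> qa; have [q0|qn0] := eqVneq q 0.
  by split; [have := coef_Poly [:: x0; x1; x2] 0|have := coef_Poly [:: x0; x1; x2] 1
    |have := coef_Poly [:: x0; x1; x2] 2]; rewrite -/q q0 coef0.
have : coprimep p q.
  rewrite coprimep_sym.
  have := irr.2 (gcdp q p); rewrite /coprimep.
  case: eqVneq => // ne /(_ isT (dvdp_gcdr _ _)) /eqp_size e.
  have := dvdp_leq qn0 (dvdp_gcdl q p).
  by rewrite e sp => /leq_trans /(_ sq).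
case/Bezout_eq1_coprimepP => -[u v] /= e.
have := congr1 (fun r : {poly rat} => (map_poly (in_alg K) r).[a]) e.
rewrite rmorphD !rmorphM rmorph1 /= !hornerE pa qa !mulr0 addr0 => /eqP.
by rewrite eq_sym oner_eq0.
Qed.

(* For [a], [b] coprime and squarefree, [al] and [be] are the cube roots of
   [a b^2] and [a^2 b]; unlike a single generator, this pair keeps the roles of
   [a] and [b] symmetric. *)
Record pure_pair (K : fieldExtType rat) (a b : nat) (al be : K) : Prop := PurePair {
  pp_a0 : (0 < a)%N;
  pp_b0 : (0 < b)%N;
  pp_sqa : squarefree a;
  pp_sqb : squarefree b;
  pp_cop : coprime a b;
  pp_alal : al * al = b%:R * be;
  pp_bebe : be * be = a%:R * al;
  pp_albe : al * be = a%:R * b%:R;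
  pp_basis : basis3 al be }.

Lemma comb3C (K : fieldExtType rat) (u v : K) x0 x1 x2 :
  comb3 u v x0 x1 x2 = comb3 v u x0 x2 x1.
Proof. by rewrite /comb3 addrAC. Qed.

Lemma basis3C (K : fieldExtType rat) (u v : K) : basis3 u v -> basis3 v u.
Proof.
move=> [sp fr]; split=> [x|x0 x1 x2].
  by have [x0 [x1 [x2 ->]]] := sp x; exists x0, x2, x1; rewrite comb3C.
by rewrite comb3C => /fr[].
Qed.

Lemma pure_pairC (K : fieldExtType rat) a b (al be : K) :
  pure_pair a b al be -> pure_pair b a be al.
Proof.
move=> [a0 b0 sqa sqb cop h1 h2 h3 bas]; split=> //; last exact: basis3C.
  by rewrite coprime_sym.
by rewrite mulrC h3 mulrC.
Qed.

Lemma basis3_scale (K : fieldExtType rat) (u v : K) (p q : rat) :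
  p != 0 -> q != 0 -> basis3 u v -> basis3 (in_alg K p * u) (in_alg K q * v).
Proof.
move=> p0 q0 [sp fr].
have E x0 x1 x2 : comb3 (in_alg K p * u) (in_alg K q * v) x0 x1 x2 =
    comb3 u v x0 (x1 * p) (x2 * q).
  by rewrite /comb3 !rmorphM /= !mulrA.
split=> [x|x0 x1 x2].
  have [x0 [x1 [x2 ->]]] := sp x; exists x0, (x1 / p), (x2 / q).
  by rewrite E !divfK.
rewrite E => /fr[-> /eqP + /eqP]; rewrite !mulf_eq0 (negPf p0) (negPf q0) !orbF.
by move=> /eqP-> /eqP->.
Qed.

(** The generator may be rescaled by any rational q, which multiplies m by q^3. The least positive
    integer N obtained in this way is cube-free: if h^3 divides N, then q / h yields a smaller
    one. *)
Lemma pure_pair_exists (K : fieldExtType rat) :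
  is_pure_cubic K -> exists a b (al be : K), pure_pair a b al be.
Proof.
move=> [m [ncube [g [g3 gen]]]].
pose good (N : nat) := (0 < N)%N /\ exists2 q : rat, q != 0 & (q ^+ 3 * m = N%:R).
have m0 : m != 0 by apply/eqP => m0; apply: (ncube 0); rewrite m0 expr0n.
have exN : exists N, `[< good N >].
  (* This is |m| times the cube of the denominator; the sign of m goes into q. *)
  exists (absz (numq m) * absz (denq m) ^ 2)%N; apply/asboolP; split.
    by rewrite muln_gt0 expn_gt0 !absz_gt0 numq_eq0 m0 denq_eq0.
  have D0 : (denq m)%:~R != 0 :> rat by rewrite intr_eq0 denq_eq0.
  have eD : (absz (denq m))%:R = (denq m)%:~R :> rat.
    by rewrite natr_absz ger0_norm.
  have [n0|n0] := leP 0 (numq m).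
    exists (denq m)%:~R => //; rewrite natrM natrX eD natr_absz ger0_norm// numqE.
    by ring.
  exists (- (denq m)%:~R); first by rewrite oppr_eq0.
  rewrite natrM natrX eD natr_absz ltr0_norm// mulrNz numqE.
  by ring.
case: (ex_minnP exN) => N /asboolP[N0 [q q0 eN]] minN.
have cfN (h : nat) : (h ^ 3 %| N)%N -> h = 1%N.
  move=> /dvdnP[k ek].
  have h0 : (0 < h)%N by rewrite lt0n; apply: contraTneq N0 => h0; rewrite ek h0 exp0n// muln0.
  have k0 : (0 < k)%N by rewrite lt0n; apply: contraTneq N0 => k0; rewrite ek k0.
  have hr : h%:R != 0 :> rat by rewrite pnatr_eq0 -lt0n.
  have : (N <= k)%N.
    apply: minN; apply/asboolP; split=> //; exists (q / h%:R).
      by rewrite mulf_neq0// invr_eq0.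
    rewrite expr_div_n mulrAC eN ek natrM natrX mulfK// expf_neq0//.
  rewrite ek -[X in (_ <= X)%N]muln1 leq_pmul2l//.
  have := leq_pexp2l h0 (isT : (1 <= 3)%N).
  by rewrite expn1; lia.
have [a [b [[a0 b0 eab] [sqa sqb cop]]]] := cubefree_split N0 cfN.
have bK : in_alg K b%:R = b%:R by rewrite rmorph_nat.
have bn0 : (b%:R : K) != 0.
  by rewrite -bK fmorph_eq0 pnatr_eq0 -lt0n.
pose al := in_alg K q * g; pose be := al ^+ 2 / b%:R.
have al3 : al ^+ 3 = a%:R * b%:R ^+ 2.
  by rewrite exprMn g3 -[m%:A]/(in_alg K m) -rmorphXn -rmorphM /= eN eab natrM natrX
    -[_%:A]/(in_alg K _) rmorphM rmorphXn !rmorph_nat.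
exists a, b, al, be; split=> //.
- by rewrite /be; field.
- have -> : be * be = al ^+ 3 * al / b%:R ^+ 2 by rewrite /be; field.
  by rewrite al3; field.
- have -> : al * be = al ^+ 3 / b%:R by rewrite /be; field.
  by rewrite al3; field.
- have -> : be = in_alg K (q ^+ 2 / b%:R) * g ^+ 2.
    by rewrite /be /al -bK exprMn rmorphM fmorphV rmorphXn mulrAC.
  apply: basis3_scale => //; first by rewrite mulf_neq0 ?expf_neq0// invr_eq0 pnatr_eq0 -lt0n.
  exact: cube_root_basis g3 gen.
Qed.

(** * Algebraic integers and coordinates in a cubic basis *)

Lemma ring_of_integersD (K : fieldExtType rat) (x y : K) :
  ring_of_integers x -> ring_of_integers y -> ring_of_integers (x + y).
Proof. exact: integral_add. Qed.

Lemma ring_of_integersM (K : fieldExtType rat) (x y : K) :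
  ring_of_integers x -> ring_of_integers y -> ring_of_integers (x * y).
Proof. exact: integral_mul. Qed.

Lemma ring_of_integersB (K : fieldExtType rat) (x y : K) :
  ring_of_integers x -> ring_of_integers y -> ring_of_integers (x - y).
Proof. exact: integral_sub. Qed.

Lemma ring_of_integers_int (K : fieldExtType rat) (n : int) :
  ring_of_integers (n%:~R : K).
Proof. exact: integral_id. Qed.

Lemma ring_of_integers_cubic (K : fieldExtType rat) (x : K) (e1 e2 e3 : int) :
  x ^+ 3 - e1%:~R * x ^+ 2 + e2%:~R * x - e3%:~R = 0 -> ring_of_integers x.
Proof.
move=> h; exists (Poly [:: - e3; e2; - e1; 1]).
  rewrite monicE lead_coefE (@PolyK _ 0) //=.
rewrite map_Poly /root horner_Poly /= rmorph1 !rmorphN /=; apply/eqP; rewrite -[RHS]h.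
by ring.
Qed.

Lemma integral_image (K : fieldExtType rat) (F : fieldType)
    (phi : {rmorphism K -> F}) (x : K) :
  ring_of_integers x -> integralOver (intr : int -> F) (phi x).
Proof.
move=> [p mp rp]; exists p => //.
have -> : map_poly (intr : int -> F) p = map_poly phi (map_poly (intr : int -> K) p).
  by rewrite -map_poly_comp; apply: eq_map_poly => z /=; rewrite rmorph_int.
by rewrite fmorph_root.
Qed.

Lemma rmorph_in_alg (K : fieldExtType rat) (F : numFieldType)
    (phi : {rmorphism K -> F}) (q : rat) : phi (in_alg K q) = ratr q.
Proof. by rewrite -(fmorph_eq_rat (phi \o in_alg K)). Qed.

Lemma rmorph_comb3 (K : fieldExtType rat) (F : numFieldType)
    (phi : {rmorphism K -> F}) (u v : K) x0 x1 x2 :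
  phi (comb3 u v x0 x1 x2) = ratr x0 + ratr x1 * phi u + ratr x2 * phi v.
Proof. by rewrite /comb3 !rmorphD !rmorphM !rmorph_in_alg. Qed.

Lemma comb3D (K : fieldExtType rat) (u v : K) x0 x1 x2 y0 y1 y2 :
  comb3 u v x0 x1 x2 + comb3 u v y0 y1 y2 = comb3 u v (x0 + y0) (x1 + y1) (x2 + y2).
Proof. by rewrite /comb3; ring. Qed.

Lemma comb3B (K : fieldExtType rat) (u v : K) x0 x1 x2 y0 y1 y2 :
  comb3 u v x0 x1 x2 - comb3 u v y0 y1 y2 = comb3 u v (x0 - y0) (x1 - y1) (x2 - y2).
Proof. by rewrite /comb3; ring. Qed.

Lemma comb3Z (K : fieldExtType rat) (u v : K) (c x0 x1 x2 : rat) :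
  in_alg K c * comb3 u v x0 x1 x2 = comb3 u v (c * x0) (c * x1) (c * x2).
Proof. by rewrite /comb3; ring. Qed.

Lemma comb3_inj (K : fieldExtType rat) (u v : K) x0 x1 x2 y0 y1 y2 :
  basis3 u v -> comb3 u v x0 x1 x2 = comb3 u v y0 y1 y2 ->
  [/\ x0 = y0, x1 = y1 & x2 = y2].
Proof.
move=> [_ fr] /eqP; rewrite -subr_eq0 comb3B => /eqP /fr[].
by move=> /eqP + /eqP + /eqP; rewrite !subr_eq0 => /eqP-> /eqP-> /eqP->.
Qed.

(** * Multiplication, embeddings and symmetric functions in a pure cubic field *)

Section PurePair.
Variables (K : fieldExtType rat) (a b : nat) (al be : K).
Hypothesis pab : pure_pair a b al be.

Lemma comb3M x0 x1 x2 y0 y1 y2 :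
  comb3 al be x0 x1 x2 * comb3 al be y0 y1 y2 =
  comb3 al be (x0 * y0 + a%:R * b%:R * (x1 * y2 + x2 * y1))
    (x0 * y1 + x1 * y0 + a%:R * (x2 * y2)) (x0 * y2 + x2 * y0 + b%:R * (x1 * y1)).
Proof.
rewrite /comb3.
set A := in_alg K.
transitivity (A x0 * A y0 + (A x1 * A y2 + A x2 * A y1) * (al * be) +
   (A x1 * A y1) * (al * al) + (A x2 * A y2) * (be * be) +
   (A x0 * A y1 + A x1 * A y0) * al + (A x0 * A y2 + A x2 * A y0) * be); first by ring.
rewrite (pp_albe pab) (pp_alal pab) (pp_bebe pab).
by rewrite /A; ring.
Qed.

(** The three relations are the whole multiplication table of the basis 1, al, be, so the map
    defined on coordinates is multiplicative. The target stays general: [algC] serves integrality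
    and traces, [R[i]] the Minkowski form. *)
Lemma pure_pair_rmorph (F : numFieldType) (r1 r2 : F) :
  r1 * r1 = b%:R * r2 -> r2 * r2 = a%:R * r1 -> r1 * r2 = a%:R * b%:R ->
  exists phi : {rmorphism K -> F}, phi al = r1 /\ phi be = r2.
Proof.
move=> h1 h2 h3; have bas := pp_basis pab.
have /choice[c cE] : forall x, exists c : rat * rat * rat,
    x = comb3 al be c.1.1 c.1.2 c.2.
  by move=> x; have [x0 [x1 [x2 ->]]] := bas.1 x; exists (x0, x1, x2).
pose f x : F := ratr (c x).1.1 + ratr (c x).1.2 * r1 + ratr (c x).2 * r2.
have fE x0 x1 x2 : f (comb3 al be x0 x1 x2) = ratr x0 + ratr x1 * r1 + ratr x2 * r2.
  by have [e0 e1 e2] := comb3_inj bas (cE (comb3 al be x0 x1 x2)); rewrite /f -e0 -e1 -e2.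
have fB : zmod_morphism f.
  move=> x y; have [x0 [x1 [x2 ->]]] := bas.1 x; have [y0 [y1 [y2 ->]]] := bas.1 y.
  by rewrite comb3B !fE; ring.
have fM : monoid_morphism f.
  split.
    have -> : 1 = comb3 al be 1 0 0 by rewrite /comb3 !rmorph1 !rmorph0; ring.
    by rewrite fE rmorph1 rmorph0; ring.
  move=> x y; have [x0 [x1 [x2 ->]]] := bas.1 x; have [y0 [y1 [y2 ->]]] := bas.1 y.
  rewrite comb3M !fE; set A : {rmorphism rat -> F} := ratr.
  transitivity (A x0 * A y0 + (A x1 * A y2 + A x2 * A y1) * (r1 * r2) +
     (A x1 * A y1) * (r1 * r1) + (A x2 * A y2) * (r2 * r2) +
     (A x0 * A y1 + A x1 * A y0) * r1 + (A x0 * A y2 + A x2 * A y0) * r2); last by ring.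
  rewrite h1 h2 h3.
  by rewrite !(rmorphD, rmorphM, rmorph_nat) /=; ring.
pose phi : {rmorphism K -> F} := HB.pack f
  (GRing.isZmodMorphism.Build K F f fB) (GRing.isMonoidMorphism.Build K F f fM).
exists phi; rewrite /phi /=; split.
  have {1}-> : al = comb3 al be 0 1 0 by rewrite /comb3 !rmorph1 !rmorph0; ring.
  by rewrite fE rmorph1 rmorph0; ring.
have {1}-> : be = comb3 al be 0 0 1 by rewrite /comb3 !rmorph1 !rmorph0; ring.
by rewrite fE rmorph1 rmorph0; ring.
Qed.

Lemma pure_pair_rmorph3 (F : numFieldType) (r1 r2 z : F) :
  r1 * r1 = b%:R * r2 -> r2 * r2 = a%:R * r1 -> r1 * r2 = a%:R * b%:R ->
  z ^+ 2 + z + 1 = 0 ->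
  exists phi psi chi : {rmorphism K -> F},
    [/\ phi al = r1 /\ phi be = r2, psi al = z * r1 /\ psi be = z ^+ 2 * r2 &
        chi al = z ^+ 2 * r1 /\ chi be = z * r2].
Proof.
move=> h1 h2 h3 hz.
have z3 : z ^+ 3 = 1.
  by apply/eqP; rewrite -subr_eq0 -(mulr0 (z - 1)) -hz; apply/eqP; ring.
have z4 : z ^+ 4 = z by rewrite (exprS z 3) z3 mulr1.
have [phi hphi] := pure_pair_rmorph h1 h2 h3.
have [psi hpsi] : exists phi : {rmorphism K -> F}, phi al = z * r1 /\ phi be = z ^+ 2 * r2.
  apply: pure_pair_rmorph.
  - by rewrite [LHS](_ : _ = z ^+ 2 * (r1 * r1)); [rewrite h1 ; ring|ring].
  - by rewrite [LHS](_ : _ = z ^+ 4 * (r2 * r2)); [rewrite h2  z4; ring|ring].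
  - by rewrite [LHS](_ : _ = z ^+ 3 * (r1 * r2)); [rewrite h3  z3; ring|ring].
have [chi hchi] : exists phi : {rmorphism K -> F}, phi al = z ^+ 2 * r1 /\ phi be = z * r2.
  apply: pure_pair_rmorph.
  - by rewrite [LHS](_ : _ = z ^+ 4 * (r1 * r1)); [rewrite h1  z4; ring|ring].
  - by rewrite [LHS](_ : _ = z ^+ 2 * (r2 * r2)); [rewrite h2 ; ring|ring].
  - by rewrite [LHS](_ : _ = z ^+ 3 * (r1 * r2)); [rewrite h3  z3; ring|ring].
by exists phi, psi, chi.
Qed.

Lemma pure_pair_algC : exists r1 r2 z : algC,
  [/\ r1 * r1 = b%:R * r2, r2 * r2 = a%:R * r1, r1 * r2 = a%:R * b%:R &
      z ^+ 2 + z + 1 = 0].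
Proof.
have bn0 : b%:R != 0 :> algC by rewrite pnatr_eq0 -lt0n (pp_b0 pab).
pose r1 : algC := 3.-root (a%:R * b%:R ^+ 2).
pose r2 : algC := r1 ^+ 2 / b%:R.
have r13 : r1 ^+ 3 = a%:R * b%:R ^+ 2 by rewrite rootCK.
have h1 : r1 * r1 = b%:R * r2 by rewrite /r2; field.
have h2 : r2 * r2 = a%:R * r1.
  have -> : r2 * r2 = r1 ^+ 3 * r1 / b%:R ^+ 2 by rewrite /r2; field.
  by rewrite r13; field.
have h3 : r1 * r2 = a%:R * b%:R.
  have -> : r1 * r2 = r1 ^+ 3 / b%:R by rewrite /r2; field.
  by rewrite r13; field.
pose z : algC := (-1 + sqrtC (-3)) / 2.
have hz : z ^+ 2 + z + 1 = 0.
  have := sqrtCK (-3); rewrite /z; set s := sqrtC _ => hs.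
  have -> : ((-1 + s) / 2) ^+ 2 + (-1 + s) / 2 + 1 = (s ^+ 2 + 3) / 4 by field.
  by rewrite hs; field.
by exists r1, r2, z.
Qed.

(** The three rationals are the trace, the second symmetric function and the norm of x; as
    polynomials in the conjugates of x in [algC] they are integral. *)
Lemma pure_integral (x0 x1 x2 : rat) :
  ring_of_integers (comb3 al be x0 x1 x2) ->
  [/\ exists n : int, 3 * x0 = n%:~R,
      exists n : int, 3 * (x0 ^+ 2 - a%:R * b%:R * x1 * x2) = n%:~R &
      exists n : int, x0 ^+ 3 + a%:R * b%:R ^+ 2 * x1 ^+ 3 + a%:R ^+ 2 * b%:R * x2 ^+ 3
         - 3 * a%:R * b%:R * x0 * x1 * x2 = n%:~R].
Proof.
have [r1 [r2 [z [h1 h2 h3 hz]]]] := pure_pair_algC.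
have [phi [psi [chi [[p1 p2] [q1 q2] [s1 s2]]]]] := pure_pair_rmorph3 h1 h2 h3 hz.
set x := comb3 _ _ _ _ _ => Ox.
have r13 : r1 ^+ 3 = a%:R * b%:R ^+ 2.
  by rewrite exprS expr2 h1 mulrCA h3; ring.
have r23 : r2 ^+ 3 = a%:R ^+ 2 * b%:R.
  by rewrite exprS expr2 h2 mulrCA (mulrC r2) h3; ring.
have z2 : z ^+ 2 = - z - 1.
  by apply/eqP; rewrite -subr_eq0 -hz; apply/eqP; ring.
pose X0 : algC := ratr x0; pose X1 : algC := ratr x1; pose X2 : algC := ratr x2.
have e1 : phi x = X0 + X1 * r1 + X2 * r2 by rewrite rmorph_comb3 p1 p2.
have e2 : psi x = X0 + X1 * (z * r1) + X2 * ((- z - 1) * r2).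
  by rewrite rmorph_comb3 q1 q2 z2.
have e3 : chi x = X0 + X1 * ((- z - 1) * r1) + X2 * (z * r2).
  by rewrite rmorph_comb3 s1 s2 z2.
have O1 := integral_image phi Ox.
have O2 := integral_image psi Ox.
have O3 := integral_image chi Ox.
pose A : {rmorphism rat -> algC} := ratr.
split.
- apply: (int_of_integral_rat (phi := A)).
  rewrite (_ : A (3 * x0) = phi x + psi x + chi x).
    by do 2?[apply: integral_add].
  by rewrite e1 e2 e3 /A rmorphM /= -/X0 rmorph_nat; ring.
- apply: (int_of_integral_rat (phi := A)).
  rewrite (_ : A _ = phi x * psi x + phi x * chi x + psi x * chi x).
    by do 2?[apply: integral_add]; apply: integral_mul.
  transitivity (3 * X0 ^+ 2 - 3 * (r1 * r2) * X1 * X2).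
    by rewrite h3 /A /X0 /X1 /X2; ring.
  rewrite e1 e2 e3.
  apply/eqP; rewrite -subr_eq0; apply/eqP.
  (* Both sides agree only modulo z^2 + z + 1; the second factor is the quotient of their
     difference. *)
  rewrite (_ : _ - _ = (z ^+ 2 + z + 1) * (X1 ^+ 2 * r1 ^+ 2 + X2 ^+ 2 * r2 ^+ 2 - 2 * X1 * X2 * r1 * r2)); first by rewrite hz mul0r.
  by ring.
- apply: (int_of_integral_rat (phi := A)).
  rewrite (_ : A _ = phi x * psi x * chi x).
    by do 2?[apply: integral_mul].
  transitivity (X0 ^+ 3 + r1 ^+ 3 * X1 ^+ 3 + r2 ^+ 3 * X2 ^+ 3 - 3 * (r1 * r2) * X0 * X1 * X2).
    by rewrite h3 r13 r23 /A /X0 /X1 /X2; ring.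
  rewrite e1 e2 e3.
  apply/eqP; rewrite -subr_eq0; apply/eqP.
  rewrite (_ : _ - _ = (z ^+ 2 + z + 1) * ((X0 + X1 * r1 + X2 * r2) * (X1 * r1 - X2 * r2) ^+ 2)); first by rewrite hz mul0r.
  by ring.
Qed.

End PurePair.

(** * Arithmetic modulo 3 *)

Lemma int_mod3 (x : int) : exists q r : int, x = 3 * q + r /\ (r = 0 \/ r = 1 \/ r = -1).
Proof.
have := divz_eq x 3; have := ltz_pmod x (isT : 0 < 3 :> int).
have := modz_ge0 x (isT : 3 != 0 :> int).
set q := (x %/ 3)%Z; set r := (x %% 3)%Z => r0 r3 e.
have [r2|r2] := eqVneq r 2.
  by exists (q + 1), (-1); split; [lia|right; right].
by exists q, r; split; lia.
Qed.

Lemma three_divM (x y k : int) : x * y = 3 * k ->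
  (exists q, x = 3 * q) \/ (exists q, y = 3 * q).
Proof.
have [q [r [-> hr]]] := int_mod3 x; have [s [t [-> ht]]] := int_mod3 y.
case: hr => [->|hr]; first by move=> _; left; exists q; rewrite addr0.
case: ht => [->|ht]; first by move=> _; right; exists s; rewrite addr0.
by move=> e; exfalso; case: hr ht e => -> [] ->; lia.
Qed.

Lemma three_divX (x k : int) n : x ^+ n = 3 * k -> exists q, x = 3 * q.
Proof.
elim: n k => [|n ih] k; first by rewrite expr0; lia.
by rewrite exprS => /three_divM[//|[q]]; apply: ih.
Qed.

Lemma sqr_mod3 (x : int) : ~ (exists q, x = 3 * q) -> exists q, x ^+ 2 = 1 + 3 * q.
Proof.
have [q [r [-> [->|hr]]]] := int_mod3 x; first by case; exists q; rewrite addr0.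
move=> _; case: hr => ->.
  by exists (3 * q ^+ 2 + 2 * q); ring.
by exists (3 * q ^+ 2 - 2 * q); ring.
Qed.

Lemma squarefree_dvdz (a b n : nat) (c k : int) : squarefree a -> coprime a b ->
  b%:Z ^+ n * c ^+ 3 = a%:Z * k -> exists c', c = a%:Z * c'.
Proof.
move=> sqa cop e.
have : (a %| absz (b%:Z ^+ n * c ^+ 3)%R)%N by rewrite e abszM dvdn_mulr.
rewrite abszM !abszX Gauss_dvdr ?coprimeXr// => /(squarefree_dvdn_cube sqa) h.
have /dvdzP[q ->] : (a%:Z %| c)%Z by rewrite dvdzE.
by exists q; rewrite mulrC.
Qed.

(** Modulo a the equation gives a | c, modulo b it gives b | d. After division by a b it reads a^2
    c1^3 + b^2 d1^3 = k a b, and the same argument with a and b exchanged gives the other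
    factors. *)
Lemma squarefree_cube_sum (a b : nat) (c d k : int) :
  (0 < a)%N -> (0 < b)%N -> squarefree a -> squarefree b -> coprime a b ->
  b%:Z * c ^+ 3 + a%:Z * d ^+ 3 = k * a%:Z ^+ 2 * b%:Z ^+ 2 ->
  (exists c', c = a%:Z * b%:Z * c') /\ (exists d', d = a%:Z * b%:Z * d').
Proof.
move=> a0 b0 sqa sqb cop e.
have cop' : coprime b a by rewrite coprime_sym.
have [c1 ec] : exists c1, c = a%:Z * c1.
  apply: (@squarefree_dvdz a b 1 c (k * a%:Z * b%:Z ^+ 2 - d ^+ 3)) => //; lra.
have [d1 ed] : exists d1, d = b%:Z * d1.
  apply: (@squarefree_dvdz b a 1 d (k * a%:Z ^+ 2 * b%:Z - c ^+ 3)) => //; lra.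
have e1 : a%:Z ^+ 2 * c1 ^+ 3 + b%:Z ^+ 2 * d1 ^+ 3 = k * a%:Z * b%:Z.
  have ab0 : a%:Z * b%:Z != 0 by lia.
  apply: (mulfI ab0); rewrite ec ed in e; lra.
have [c2 ec2] : exists c2, c1 = b%:Z * c2.
  apply: (@squarefree_dvdz b a 2 c1 (k * a%:Z - b%:Z * d1 ^+ 3)) => //; lra.
have [d2 ed2] : exists d2, d1 = a%:Z * d2.
  apply: (@squarefree_dvdz a b 2 d1 (k * b%:Z - a%:Z * c1 ^+ 3)) => //; lra.
by split; [exists c2; rewrite ec ec2 mulrA|exists d2; rewrite ed ed2; ring].
Qed.

(** This is the norm form with 3 a in place of a. As in Eisenstein's criterion, the three cubes
    carry the coefficients 1, 3, 9 up to factors prime to 3, so y0, y1, y2 are found divisible by 3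
    one after the other. *)
Lemma three_div_norm_dvd (a b y0 y1 y2 l : int) :
  ~ (exists q, a = 3 * q) -> ~ (exists q, b = 3 * q) ->
  y0 ^+ 3 + 3 * a * b ^+ 2 * y1 ^+ 3 + 9 * a ^+ 2 * b * y2 ^+ 3 - 9 * a * b * y0 * y1 * y2
   = 27 * l ->
  [/\ exists q, y0 = 3 * q, exists q, y1 = 3 * q & exists q, y2 = 3 * q].
Proof.
move=> na nb e.
have [z0 e0] : exists q, y0 = 3 * q.
  apply: (@three_divX _ (9 * l - a * b ^+ 2 * y1 ^+ 3 - 3 * a ^+ 2 * b * y2 ^+ 3 + 3 * a * b * y0 * y1 * y2) 3); lra.
have [z1 e1] : exists q, y1 = 3 * q.
  have : a * (b ^+ 2 * y1 ^+ 3) =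
     3 * (l - z0 ^+ 3 - a ^+ 2 * b * y2 ^+ 3 + a * b * z0 * y1 * y2 + 2 * l - 2 * z0 ^+ 3 + 2 * a * b * z0 * y1 * y2).
    by rewrite e0 in e; lra.
  by move=> /three_divM[//|[k /three_divM[[k2 /three_divX]//|[k2 /three_divX]]]].
have [z2 e2] : exists q, y2 = 3 * q.
  have : a ^+ 2 * (b * y2 ^+ 3) = 3 * (l - z0 ^+ 3 - 3 * a * b ^+ 2 * z1 ^+ 3 + 3 * a * b * z0 * z1 * y2).
    by rewrite e0 e1 in e; lra.
  by move=> /three_divM[[k /three_divX]//|[k /three_divM[//|[k2 /three_divX]]]].
by split; [exists z0|exists z1|exists z2].
Qed.

(** With m = a b^2, the second alternative says that y0 (y0, y1, y2) is congruent modulo 3 to (1, m,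
    m^2 b), the numerators of [tame_elt]: modulo Z[al, be] there is only one possible new integer up
    to a factor. The reason is that y0, a y1 and b y2 are all congruent modulo 3. *)
Lemma three_div_norm_coprime (a b y0 y1 y2 k l : int) :
  ~ (exists q, a = 3 * q) -> ~ (exists q, b = 3 * q) ->
  y0 ^+ 2 - a * b * y1 * y2 = 3 * k ->
  y0 ^+ 3 + a * b ^+ 2 * y1 ^+ 3 + a ^+ 2 * b * y2 ^+ 3 - 3 * a * b * y0 * y1 * y2
   = 3 * l ->
  [/\ exists q, y0 = 3 * q, exists q, y1 = 3 * q & exists q, y2 = 3 * q] \/
  [/\ exists q, y0 ^+ 2 = 1 + 3 * q, exists q, y0 * y1 = a * b ^+ 2 + 3 * q &
      exists q, y0 * y2 = (a * b ^+ 2) ^+ 2 * b + 3 * q].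
Proof.
move=> na nb e2 e3.
have [[z0 e0]|n0] := pselect (exists q, y0 = 3 * q); last right.
  left.
  have h1 : (exists q, y1 = 3 * q) -> exists q, y2 = 3 * q.
    move=> [z1 e1].
    have : a ^+ 2 * (b * y2 ^+ 3) = 3 * (l - 9 * z0 ^+ 3 - 9 * a * b ^+ 2 * z1 ^+ 3 + 9 * a * b * z0 * z1 * y2).
      by rewrite e0 e1 in e3; lra.
    by move=> /three_divM[[? /three_divX]//|[? /three_divM[//|[? /three_divX]]]].
  have h2 : (exists q, y2 = 3 * q) -> exists q, y1 = 3 * q.
    move=> [z2 e1].
    have : a * (b ^+ 2 * y1 ^+ 3) = 3 * (l - 9 * z0 ^+ 3 - 9 * a ^+ 2 * b * z2 ^+ 3 + 9 * a * b * z0 * y1 * z2).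
      by rewrite e0 e1 in e3; lra.
    by move=> /three_divM[//|[? /three_divM[[? /three_divX]//|[? /three_divX]]]].
  have : a * (b * (y1 * y2)) = 3 * (3 * z0 ^+ 2 - k) by rewrite e0 in e2; lra.
  have z0E : exists q, y0 = 3 * q by exists z0.
  move=> /three_divM[//|[? /three_divM[//|[? /three_divM[d|d]]]]].
    by split=> //; exact: h1.
  by split=> //; exact: h2.
have n1 : ~ exists q, y1 = 3 * q.
  move=> [z1 e1]; apply: n0; apply: (@three_divX _ (k + a * b * z1 * y2) 2).
  by rewrite e1 in e2; lra.
have n2 : ~ exists q, y2 = 3 * q.
  move=> [z1 e1]; apply: n0; apply: (@three_divX _ (k + a * b * y1 * z1) 2).
  by rewrite e1 in e2; lra.
have [i0 s0] := sqr_mod3 n0; have [i1 s1] := sqr_mod3 n1; have [i2 s2] := sqr_mod3 n2.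
have [ia sa] := sqr_mod3 na; have [ib sb] := sqr_mod3 nb.
(* As cubing is the identity mod 3, the norm is congruent to its linear analogue. *)
have [j ej] : exists j, y0 + a * y1 + b * y2 = 3 * j.
  exists (l + a * b * y0 * y1 * y2 - i0 * y0 - a * y1 * (ib + i1 + 3 * ib * i1)
     - b * y2 * (ia + i2 + 3 * ia * i2)).
  have c0 : y0 ^+ 3 = y0 * (1 + 3 * i0) by rewrite exprS s0.
  have c1 : y1 ^+ 3 = y1 * (1 + 3 * i1) by rewrite exprS s1.
  have c2 : y2 ^+ 3 = y2 * (1 + 3 * i2) by rewrite exprS s2.
  rewrite c0 c1 c2 sa sb in e3; lra.
(* With y0 congruent to - a y1 - b y2, the quadratic condition becomes (a y1 - b y2)^2 = 0 modulo
   3. *)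
have [d ed] : exists d, a * y1 - b * y2 = 3 * d.
  apply: (@three_divX _ (k - a * b * y1 * y2 - 3 * j ^+ 2 + 2 * j * (a * y1 + b * y2)) 2).
  have h : y0 = 3 * j - a * y1 - b * y2 by lra.
  by rewrite h in e2; lra.
have ey1 : y0 = a * y1 + 3 * (j - a * y1 + d) by lra.
have ey2 : y0 = b * y2 + 3 * (j - b * y2 - d) by lra.
split; first by exists i0.
  exists (a * i1 - a * ib + (j - a * y1 + d) * y1).
  by rewrite {1}ey1 sb mulrDl -mulrA -expr2 s1; ring.
exists (b * i2 + (j - b * y2 - d) * y2 - b * (ia + 2 * ib + 3 * ib ^+ 2 + 6 * ia * ib + 9 * ia * ib ^+ 2)).
rewrite {1}ey2 mulrDl -mulrA -expr2 s2.
rewrite (_ : (a * b ^+ 2) ^+ 2 = a ^+ 2 * (b ^+ 2) ^+ 2); last by ring.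
by rewrite sa sb; ring.
Qed.

(** A square divisible by 27 has a root divisible by 9. With m^2 = 1 + 3 k this makes k (2 + 3 k),
    hence k, a multiple of 3. For m prime to 3, the conclusion is the condition that m is 1 or -1
    modulo 9, free of a choice of sign. *)
Lemma nine_div_sub_cube (m l : int) : ~ (exists q, m = 3 * q) ->
  (1 - m ^+ 4) ^+ 2 = 27 * l -> exists k, m - m ^+ 3 = 9 * k.
Proof.
move=> nm e.
have [w ew] : exists w, 1 - m ^+ 4 = 3 * w.
  by apply: (@three_divX _ (9 * l) 2); lra.
have [v ev] : exists v, w = 3 * v.
  by apply: (@three_divX _ l 2); rewrite ew in e; lra.
have [k ek] := sqr_mod3 nm.
have : k * (2 + 3 * k) = 3 * - v.
  have : m ^+ 4 = (1 + 3 * k) ^+ 2 by rewrite -ek; ring.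
  by rewrite ev in ew; lra.
move=> /three_divM[[q eq]|[q eq]]; last by lia.
by exists (- m * q); rewrite exprS ek eq; ring.
Qed.

(** * Integers of a pure cubic field *)

Lemma three_dvdn_int (n : nat) : (3 %| n)%N <-> exists q : int, n%:Z = 3 * q.
Proof.
split=> [/dvdnP[k ->]|[q e]]; first by exists k%:Z; rewrite PoszM mulrC.
by rewrite -[n]/(absz n%:Z) e abszM dvdn_mulr.
Qed.

Section PureRadicand.
Variables (K : fieldExtType rat) (a b : nat) (al be : K).
Hypothesis pab : pure_pair a b al be.

Definition pure_radicand : int := a%:Z * b%:Z ^+ 2.
Local Notation m := pure_radicand.

Lemma pure_al3 : al ^+ 3 = m%:~R.
Proof.
rewrite /m exprS expr2 (pp_alal pab) mulrCA (pp_albe pab).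
by rewrite rmorphM rmorphXn /=; ring.
Qed.

Lemma integral_al : ring_of_integers al.
Proof.
apply: (@ring_of_integers_cubic _ _ 0 0 m); rewrite pure_al3; ring.
Qed.

End PureRadicand.

Section PureIntegers.
Variables (K : fieldExtType rat) (a b : nat) (al be : K).
Hypothesis pab : pure_pair a b al be.
Local Notation m := (pure_radicand a b).

Lemma comb3_unit : [/\ al = comb3 al be 0 1 0, be = comb3 al be 0 0 1 & 
  forall q, in_alg K q = comb3 al be q 0 0].
Proof.
by split=> [||q]; rewrite /comb3 ?rmorph1 ?rmorph0; ring.
Qed.

Lemma comb3_ratint (y0 y1 y2 : int) :
  comb3 al be y0%:~R y1%:~R y2%:~R = y0%:~R + y1%:~R * al + y2%:~R * be.
Proof. by rewrite /comb3 !rmorph_int. Qed.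

Lemma integral_comb3_int (y0 y1 y2 : int) :
  ring_of_integers (comb3 al be y0%:~R y1%:~R y2%:~R).
Proof.
rewrite comb3_ratint.
have Oal := integral_al pab; have Obe := integral_al (pure_pairC pab).
apply: ring_of_integersD; [apply: ring_of_integersD|].
- exact: ring_of_integers_int.
- by apply: ring_of_integersM => //; exact: ring_of_integers_int.
- by apply: ring_of_integersM => //; exact: ring_of_integers_int.
Qed.

(** The traces of x, x be and x al are 3 x0, 3 a b x1 and 3 a b x2. To remove a b from the last two,
    the norm of 3 x - 3 x0, an integer without rational part, is fed to [squarefree_cube_sum]. *)
Lemma pure_denominator (x0 x1 x2 : rat) :
  ring_of_integers (comb3 al be x0 x1 x2) ->
  exists y0 y1 y2 : int, [/\ 3 * x0 = y0%:~R, 3 * x1 = y1%:~R & 3 * x2 = y2%:~R].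
Proof.
set x := comb3 _ _ _ _ _ => Ox.
have [a0 b0 sqa sqb cop _ _ _ _] := pab.
have [ealE ebeE eqE] := comb3_unit.
have [[y0 e0] _ _] := pure_integral pab Ox.
have [c ec] : exists c : int, 3 * (a%:R * b%:R * x1) = c%:~R.
  have : ring_of_integers (x * be).
    by apply: ring_of_integersM => //; exact: (integral_al (pure_pairC pab)).
  rewrite [X in _ * X]ebeE (comb3M pab) => /(pure_integral pab)[[c ec] _ _].
  by exists c; rewrite -ec; ring.
have [d ed] : exists d : int, 3 * (a%:R * b%:R * x2) = d%:~R.
  have : ring_of_integers (x * al).
    by apply: ring_of_integersM => //; exact: (integral_al pab).
  rewrite [X in _ * X]ealE (comb3M pab) => /(pure_integral pab)[[d ed] _ _].
  by exists d; rewrite -ed; ring.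
have [k ek] : exists k : int, a%:R * b%:R ^+ 2 * (3 * x1) ^+ 3 + a%:R ^+ 2 * b%:R * (3 * x2) ^+ 3 = k%:~R.
  have : ring_of_integers (comb3 al be 0 (3 * x1) (3 * x2)).
    have -> : comb3 al be 0 (3 * x1) (3 * x2) = 3%:~R * x - y0%:~R.
      have -> : y0%:~R = in_alg K (3 * x0) by rewrite e0 rmorph_int.
      by rewrite /x /comb3 rmorph0; ring.
    apply: ring_of_integersB; last exact: ring_of_integers_int.
    by apply: ring_of_integersM => //; exact: ring_of_integers_int.
  move=> /(pure_integral pab)[_ _ [k ek]]; exists k; rewrite -ek; ring.
have an0 : a%:R != 0 :> rat by rewrite pnatr_eq0 -lt0n.
have bn0 : b%:R != 0 :> rat by rewrite pnatr_eq0 -lt0n.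
have e : b%:Z * c ^+ 3 + a%:Z * d ^+ 3 = k * a%:Z ^+ 2 * b%:Z ^+ 2.
  apply/eqP; rewrite -(eqr_int rat).
  rewrite !(rmorphD, rmorphM, rmorphXn) /= -ec -ed -ek -!pmulrn.
  by apply/eqP; ring.
have [[c' ec'] [d' ed']] := squarefree_cube_sum a0 b0 sqa sqb cop e.
exists y0, c', d'; split=> //.
  apply: (mulfI (mulf_neq0 an0 bn0)).
  transitivity (c%:~R : rat); first by rewrite -ec; ring.
  by rewrite ec' !rmorphM.
apply: (mulfI (mulf_neq0 an0 bn0)).
transitivity (d%:~R : rat); first by rewrite -ed; ring.
by rewrite ed' !rmorphM.
Qed.

Lemma pure_thirds (y0 y1 y2 : int) :
  ring_of_integers (comb3 al be (y0%:~R / 3) (y1%:~R / 3) (y2%:~R / 3)) ->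
  (exists k, y0 ^+ 2 - a%:Z * b%:Z * y1 * y2 = 3 * k) /\
  (exists l, y0 ^+ 3 + a%:Z * b%:Z ^+ 2 * y1 ^+ 3 + a%:Z ^+ 2 * b%:Z * y2 ^+ 3
      - 3 * a%:Z * b%:Z * y0 * y1 * y2 = 27 * l).
Proof.
move=> /(pure_integral pab)[_ [k ek] [l el]]; split.
  exists k; apply/eqP; rewrite -(eqr_int rat).
  rewrite !(rmorphD, rmorphN, rmorphM, rmorphXn) /= -ek -!pmulrn.
  by apply/eqP; field.
exists l; apply/eqP; rewrite -(eqr_int rat).
rewrite !(rmorphD, rmorphN, rmorphM, rmorphXn) /= -el -!pmulrn.
by apply/eqP; field.
Qed.

Lemma integral_thirds (x : K) : ring_of_integers x ->
  exists y0 y1 y2 : int, x = comb3 al be (y0%:~R / 3) (y1%:~R / 3) (y2%:~R / 3).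
Proof.
have [x0 [x1 [x2 ->]]] := (pp_basis pab).1 x.
move=> /pure_denominator[y0 [y1 [y2 [e0 e1 e2]]]].
by exists y0, y1, y2; rewrite -e0 -e1 -e2; congr comb3; field.
Qed.

Lemma three_coprime : (3 %| a)%N -> ~ (3 %| b)%N.
Proof.
by move=> da db; have := dvdn_gcd 3 a b; rewrite da db (eqP (pp_cop pab)).
Qed.

Lemma three_exact : (3 %| a)%N -> exists2 a' : int, a%:Z = 3 * a' & ~ exists q, a' = 3 * q.
Proof.
move=> /dvdnP[k ek]; exists k%:Z; first by rewrite ek PoszM mulrC.
move=> /three_dvdn_int/dvdnP[j ej].
by have := pp_sqa pab (h := 3); rewrite ek ej -mulnA dvdn_mull// => /(_ isT).
Qed.

Lemma pure_radicand_not3 : ~ (3 %| a)%N -> ~ (3 %| b)%N -> ~ exists q, m = 3 * q.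
Proof.
move=> na nb [q]; rewrite /pure_radicand => /three_divM[/three_dvdn_int//|[k]].
by move=> /three_divX/three_dvdn_int.
Qed.

Lemma three_div_coords_dvd (y0 y1 y2 : int) : (3 %| a)%N ->
  ring_of_integers (comb3 al be (y0%:~R / 3) (y1%:~R / 3) (y2%:~R / 3)) ->
  [/\ exists q, y0 = 3 * q, exists q, y1 = 3 * q & exists q, y2 = 3 * q].
Proof.
move=> da /pure_thirds[_ [l el]].
have [a' ea na'] := three_exact da.
have nb : ~ exists q, b%:Z = 3 * q by move/three_dvdn_int; exact: three_coprime.
by apply: (three_div_norm_dvd na' nb (l := l)); rewrite -el ea; ring.
Qed.

(* The integer (1 + m al + (m al)^2) / 3 is what enlarges Z[al, be] in the tame case. *)
Definition tame_elt : K := comb3 al be (1 / 3) (m%:~R / 3) ((m ^+ 2 * b%:Z)%:~R / 3).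

(** For th = m al one has th^3 = m^4, and 1 + th + th^2 = (th^3 - 1) / (th - 1) has norm (m^4 -
    1)^2. So integrality forces 27 to divide (1 - m^4)^2. *)
Lemma tame_elt_integral_nine : ~ (3 %| a)%N -> ~ (3 %| b)%N ->
  ring_of_integers tame_elt -> exists k, m - m ^+ 3 = 9 * k.
Proof.
move=> na nb; rewrite /tame_elt -{1}[1]/(1%:~R) => /pure_thirds[_ [l el]].
apply: (nine_div_sub_cube (pure_radicand_not3 na nb) (l := l)).
by rewrite -el /pure_radicand; ring.
Qed.

End PureIntegers.

Section WildIntegers.
Variables (K : fieldExtType rat) (a b : nat) (al be : K).
Hypothesis pab : pure_pair a b al be.
Local Notation m := (pure_radicand a b).

(** If the numerators y0, y1, y2 are not all divisible by 3, then 3 divides neither a nor b and y0 x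
    differs from [tame_elt] by an element of Z[al, be]; [tame_elt] would then be integral, which the
    hypothesis excludes. *)
Lemma wild_integers (x : K) :
  (3 %| a * b)%N \/ ~ (exists k, m - m ^+ 3 = 9 * k) ->
  ring_of_integers x -> exists y0 y1 y2 : int, x = comb3 al be y0%:~R y1%:~R y2%:~R.
Proof.
move=> typ Ox; have [y0 [y1 [y2 ex]]] := integral_thirds pab Ox.
suff [[q0 e0] [q1 e1] [q2 e2]] :
    [/\ exists q, y0 = 3 * q, exists q, y1 = 3 * q & exists q, y2 = 3 * q].
  by exists q0, q1, q2; rewrite ex e0 e1 e2 !rmorphM /=; congr comb3; field.
rewrite ex in Ox.
have [da|/negP na] := boolP (3 %| a)%N; first exact: (three_div_coords_dvd pab da Ox).
have [db|/negP nb] := boolP (3 %| b)%N.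
  by rewrite comb3C in Ox; have [] := three_div_coords_dvd (pure_pairC pab) db Ox.
have [[k ek] [l el]] := pure_thirds pab Ox.
have na' : ~ exists q, a%:Z = 3 * q by move/three_dvdn_int.
have nb' : ~ exists q, b%:Z = 3 * q by move/three_dvdn_int.
have el3 : y0 ^+ 3 + a%:Z * b%:Z ^+ 2 * y1 ^+ 3 + a%:Z ^+ 2 * b%:Z * y2 ^+ 3
   - 3 * a%:Z * b%:Z * y0 * y1 * y2 = 3 * (9 * l) by rewrite el; ring.
have [//|[[q0 e0] [q1 e1] [q2 e2]]] := three_div_norm_coprime na' nb' ek el3.
exfalso; case: typ => [|nm]; first by rewrite Euclid_dvdM// => /orP[].
apply: nm; apply: (tame_elt_integral_nine pab na nb).
rewrite (_ : tame_elt _ _ _ _ = y0%:~R * comb3 al be (y0%:~R / 3) (y1%:~R / 3) (y2%:~R / 3)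
   - comb3 al be q0%:~R q1%:~R q2%:~R).
  apply: ring_of_integersB; last exact: (integral_comb3_int pab).
  by apply: ring_of_integersM => //; exact: ring_of_integers_int.
have -> : (y0%:~R : K) = in_alg K y0%:~R by rewrite rmorph_int.
rewrite comb3Z comb3B /tame_elt; congr comb3.
- have : y0%:~R ^+ 2 = 1 + 3 * q0%:~R :> rat by rewrite -rmorphXn e0 /= rmorphD rmorphM.
  by move=> h; rewrite mulrA -expr2 h; field.
- have : y0%:~R * y1%:~R = m%:~R + 3 * q1%:~R :> rat by rewrite -rmorphM e1 /= rmorphD !rmorphM.
  by move=> h; rewrite mulrA h; field.
- have : y0%:~R * y2%:~R = (m ^+ 2 * b%:Z)%:~R + 3 * q2%:~R :> rat.
    by rewrite -rmorphM e2 /= rmorphD !rmorphM.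
  by move=> h; rewrite mulrA h; field.
Qed.

(** This is the characteristic polynomial of e: trace 1, second symmetric function (1 - m^4) / 3 = 3
    k and norm (1 - m^4)^2 / 27 = 3 k^2. Modulo 3 it becomes X^2 (X - 1), which later separates two
    primes above 3. *)
Lemma tame_elt_cubic (k : int) : 1 - m ^+ 4 = 9 * k ->
  let e := tame_elt a b al be in
  e ^+ 3 - 1%:~R * e ^+ 2 + (3 * k)%:~R * e - (3 * k ^+ 2)%:~R = 0.
Proof.
move=> ek e.
have [_ _ eqE] := comb3_unit al be.
have ek' : k%:~R = (1 - m%:~R ^+ 4) / 9 :> rat.
  have : (9 * k)%:~R = (1 - m ^+ 4)%:~R :> rat by rewrite ek.
  by rewrite !(rmorphM, rmorphB, rmorphXn, rmorph1) /= => <-; field.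
have -> : (3 * k)%:~R = in_alg K ((1 - m%:~R ^+ 4) / 3).
  by rewrite -(rmorph_int (in_alg K)); congr (in_alg K _); rewrite rmorphM /= ek'; field.
have -> : (3 * k ^+ 2)%:~R = in_alg K ((1 - m%:~R ^+ 4) ^+ 2 / 27).
  by rewrite -(rmorph_int (in_alg K)); congr (in_alg K _); rewrite rmorphM rmorphXn /= ek'; field.
rewrite mul1r exprS expr2 /e /tame_elt.
rewrite [in_alg K (_ ^+ 2 / _)]eqE !(comb3M pab, comb3Z, comb3B, comb3D).
have -> : (m%:~R : rat) = a%:R * b%:R ^+ 2 by rewrite /pure_radicand rmorphM rmorphXn.
rewrite rmorphM rmorphXn /=.
have -> : (m%:~R : rat) = a%:R * b%:R ^+ 2 by rewrite /pure_radicand rmorphM rmorphXn.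
rewrite -[b%:~R]/(b%:R).
rewrite -[RHS](rmorph0 (in_alg K)) [RHS]eqE; congr comb3; by field.
Qed.

Lemma tame_elt_integral : (exists k, 1 - m ^+ 4 = 9 * k) ->
  ring_of_integers (tame_elt a b al be).
Proof. by move=> [k /tame_elt_cubic]; apply: ring_of_integers_cubic. Qed.

Lemma nine_div_fourth : ~ (3 %| a)%N -> ~ (3 %| b)%N ->
  (exists k, m - m ^+ 3 = 9 * k) -> exists k, 1 - m ^+ 4 = 9 * k.
Proof.
move=> na nb [k ek]; have nm := pure_radicand_not3 na nb.
have : m * (1 - m ^+ 2) = 3 * (3 * k) by rewrite mulrA -ek; ring.
case/three_divM => [//|[w ew]].
have : m * w = 3 * k by have : m * (1 - m ^+ 2) = 9 * k; [rewrite -ek; ring|rewrite ew; lia].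
case/three_divM => [//|[v ev]].
exists (v * (1 + m ^+ 2)).
by transitivity ((1 - m ^+ 2) * (1 + m ^+ 2)); [ring|rewrite ew ev; ring].
Qed.

End WildIntegers.

(** * Ramification at 3 *)

Lemma ring_of_integersN (K : fieldExtType rat) (x : K) :
  ring_of_integers x -> ring_of_integers (- x).
Proof. exact: integral_opp. Qed.

Lemma ring_of_integers_nat (K : fieldExtType rat) (n : nat) :
  ring_of_integers (n%:R : K).
Proof. exact: integral_nat. Qed.

Lemma ring_of_integersX (K : fieldExtType rat) (x : K) n :
  ring_of_integers x -> ring_of_integers (x ^+ n).
Proof.
move=> Ox; elim: n => [|n ih]; first exact: (ring_of_integers_nat K 1).
by rewrite exprS; apply: ring_of_integersM.
Qed.

Ltac integral := repeat first
  [ assumption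
  | apply: ring_of_integers_nat
  | apply: ring_of_integers_int
  | apply: ring_of_integersB
  | apply: ring_of_integersD
  | apply: ring_of_integersN
  | apply: ring_of_integersX
  | apply: ring_of_integersM ].

Lemma ideal_mul_in (K : fieldExtType rat) (I J : set K) (u v : K) :
  I u -> J v -> ideal_mul I J (u * v).
Proof.
by move=> Iu Jv; exists 1%N, (fun=> u), (fun=> v); split=> //; rewrite big_ord1.
Qed.

Lemma ideal_mulD (K : fieldExtType rat) (I J : set K) (x y : K) :
  ideal_mul I J x -> ideal_mul I J y -> ideal_mul I J (x + y).
Proof.
move=> [n1 [u1 [v1 [h1 ->]]]] [n2 [u2 [v2 [h2 ->]]]].
exists (n1 + n2)%N,
  (fun i => match fintype.split i with inl j => u1 j | inr j => u2 j end),
  (fun i => match fintype.split i with inl j => v1 j | inr j => v2 j end).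
split; first by move=> i; case: (fintype.split i).
rewrite big_split_ord /=; congr (_ + _); apply: eq_bigr => i _.
  by rewrite (unsplitK (inl i)).
by rewrite (unsplitK (inr i)).
Qed.

Lemma ideal_mul_sub (K : fieldExtType rat) (I J T : set K) :
  T 0 -> (forall x y, T x -> T y -> T (x + y)) ->
  (forall u v, I u -> J v -> T (u * v)) -> forall x, ideal_mul I J x -> T x.
Proof.
move=> T0 TD TM x [n [u [v [h ->]]]].
by elim/big_ind: _ => // i _; apply: TM; case: (h i).
Qed.

Section Wild.
Variables (K : fieldExtType rat) (a b : nat) (al be : K).
Hypothesis pab : pure_pair a b al be.
Local Notation m := (pure_radicand a b).
Local Notation O := (@ring_of_integers K).

(** If 3 O = P^3, the prime P contains h or h - 1, because h^2 (h - 1) lies in 3 O, and cubes of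
    elements of P lie in 3 O. Combining the two facts puts h^2, respectively h - 1, into 3 O,
    against the value of its rational coordinate. *)
Lemma wild_not_tame : ~ (3 %| a)%N -> ~ (3 %| b)%N ->
  (exists k, 1 - m ^+ 4 = 9 * k) -> ~ wildly_ramified_at_3 K.
Proof.
move=> na nb [k ek] [P [[idP P1 prP] eP]].
have [PO P0 PD PM] := idP.
pose h := tame_elt a b al be.
have Oh : O h by apply: tame_elt_integral => //; exists k.
have hcub := tame_elt_cubic pab ek; rewrite /= -/h in hcub.
have cubeP x : P x -> exists2 t, O t & x ^+ 3 = 3 * t.
  move=> Px; have : ideal_mul (ideal_mul P P) P (x * x * x).
    by apply: ideal_mul_in => //; exact: ideal_mul_in.
  rewrite -eP => -[t Ot et]; exists t => //; rewrite et; ring.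
have threeP x : O x -> P (3 * x).
  move=> Ox; have : [set 3%:R * x | x in O] (3 * x) by exists x.
  rewrite eP; apply: ideal_mul_sub => // u v Pu Pv.
  apply: (PM) => //; apply: (ideal_mul_sub (T := O) _ _ _ Pu).
  - exact: (ring_of_integers_nat K 0).
  - exact: ring_of_integersD.
  - by move=> ? ? /PO ? /PO ?; apply: ring_of_integersM.
(* Read off the cubic equation of h: h^3 - h^2 = 3 (k^2 - k h). *)
pose g : K := k%:~R ^+ 2 - k%:~R * h.
have Og : O g by rewrite /g; integral.
have hg : h * (h * (h - 1)) = 3 * g.
  apply/eqP; rewrite -subr_eq0 -[X in _ == X]hcub; apply/eqP; rewrite /g; ring.
have O1 : O 1 by exact: (ring_of_integers_nat K 1).
have Oh1 : O (h - 1) by integral.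
have : P h \/ P (h - 1).
  have : P (h * (h * (h - 1))) by rewrite hg; apply: threeP.
  by move=> /(prP _ _ Oh (ring_of_integersM Oh Oh1))[|/(prP _ _ Oh Oh1)[]]; [left|left|right].
(* The rational coordinate x0 of x = 3 s is the trace of s, hence an integer. *)
have third (s x : K) x0 x1 x2 : O s -> x = 3 * s -> x = comb3 al be x0 x1 x2 ->
    exists n : int, x0 = n%:~R.
  move=> Os ex exc.
  have es : s = comb3 al be (x0 / 3) (x1 / 3) (x2 / 3).
    rewrite (_ : s = in_alg K (1 / 3) * x).
      by rewrite exc comb3Z; congr comb3; field.
    rewrite ex; transitivity (in_alg K (1 / 3 * 3) * s).
      by rewrite mul1r mulVf// rmorph1 mul1r.
    by ring.
  rewrite es in Os; have [[n en] _ _] := pure_integral pab Os.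
  by exists n; rewrite -en; field.
case=> [/cubeP[t Ot et]|/cubeP[t Ot et]].
  have h2 : h * h = 3 * (t * h ^+ 2 - g * (h ^+ 2 + h + 1)).
    transitivity (h ^+ 3 * h ^+ 2 - h * (h * (h - 1)) * (h ^+ 2 + h + 1)); first by ring.
    by rewrite hg et; ring.
  have [|n en] := third _ _ _ _ _ _ h2 (comb3M pab _ _ _ _ _ _).
    by integral.
  (* The rational coordinate of h^2 is (1 + 2 m^4) / 9 = (1 - 6 k) / 3, never an integer. *)
  have : 3 * (3 - 18 * k) = 27 * n.
    apply/eqP; rewrite -(eqr_int rat) !(rmorphM, rmorphB) /= -en.
    have -> : 18 * k%:~R = 2 * (1 - m ^+ 4)%:~R :> rat.
      by rewrite ek rmorphM /=; ring.
    rewrite /pure_radicand !(rmorphM, rmorphB, rmorphXn, rmorph1) /=.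
    by apply/eqP; field.
  by lia.
set y := h - 1 in et.
have Oy : O y by [].
have hy : 2 * y ^+ 2 + y = 3 * (g - t).
  transitivity (h * (h * (h - 1)) - y ^+ 3); first by rewrite /y; ring.
  by rewrite hg et; ring.
have yE : y = 3 * (g - t - 2 * (g - t) * y + 4 * t).
  transitivity ((2 * y ^+ 2 + y) - 2 * y * (2 * y ^+ 2 + y) + 4 * y ^+ 3); first by ring.
  by rewrite hy et; ring.
have yc : y = comb3 al be (1 / 3 - 1) (m%:~R / 3) ((m ^+ 2 * b%:Z)%:~R / 3).
  by rewrite /y /h /tame_elt /comb3 rmorphB rmorph1; ring.
have [|n en] := third _ _ _ _ _ _ yE yc; first by integral.
(* The rational coordinate of h - 1 is 1/3 - 1. *)
have : (-2 : int) = 3 * n.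
  by apply/eqP; rewrite -(eqr_int rat) rmorphM /= -en.
by lia.
Qed.

(** With m - m^3 = 3 c, the element p = al - m satisfies p^3 = 3 (c - m al p). Since c is prime to
    3, the second factor behaves like a unit above 3, so P = (p, 3) has cube 3 O; P is prime because
    every integer is congruent to a rational one modulo P. *)
Lemma wild_of_radicand : ~ (3 %| b)%N -> ~ (exists k, m - m ^+ 3 = 9 * k) ->
  wildly_ramified_at_3 K.
Proof.
move=> nb nm.
have nb' : ~ exists q, b%:Z = 3 * q by move/three_dvdn_int.
have Oal : O al := integral_al pab.
have Obe : O be := integral_al (pure_pairC pab).
have [c ec] : exists c, m - m ^+ 3 = 3 * c.
  have [q [r [-> hr]]] := int_mod3 m.
  exists (q - 9 * q ^+ 3 - 9 * q ^+ 2 * r - 3 * q * r ^+ 2).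
  have : r - r ^+ 3 = 0 by case: hr => [->|[->|->]].
  by move=> h; transitivity ((r - r ^+ 3) + 3 * (q - 9 * q ^+ 3 - 9 * q ^+ 2 * r - 3 * q * r ^+ 2));
    [ring|rewrite h add0r].
have nc : ~ exists q, c = 3 * q by move=> [q eq]; apply: nm; exists q; rewrite ec eq; ring.
pose p : K := al - m%:~R.
have Op : O p by rewrite /p; integral.
have p3 : p ^+ 3 = 3 * (c%:~R - m%:~R * al * p).
  transitivity (al ^+ 3 - m%:~R ^+ 3 - 3 * m%:~R * al * p); first by rewrite /p; ring.
  rewrite (pure_al3 pab).
  have -> : m%:~R - m%:~R ^+ 3 = 3 * c%:~R :> K.
    by rewrite -rmorphXn -rmorphB ec rmorphM.
  by ring.
pose P : set K := [set x | exists s t, [/\ O s, O t & x = p * s + 3 * t]].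
have O1 : O 1 by exact: (ring_of_integers_nat K 1).
have O0 : O 0 by exact: (ring_of_integers_nat K 0).
have Pp s : O s -> P (p * s).
  by move=> Os; exists s, 0; split=> //; ring.
have P3 s : O s -> P (3 * s).
  by move=> Os; exists 0, s; split=> //; ring.
have idP : is_ideal P.
  split.
  - by move=> x [s [t [Os Ot ->]]]; rewrite /mkset; integral.
  - by exists 0, 0; split=> //; ring.
  - move=> x y [s [t [Os Ot ->]]] [s' [t' [Os' Ot' ->]]].
    by exists (s + s'), (t + t'); split; [integral|integral|ring].
  - move=> x y Ox [s [t [Os Ot ->]]].
    by exists (x * s), (x * t); split; [integral|integral|ring].
have [PO P0 PD PM] := idP.
have nP1 : ~ P 1.
  move=> [s [t [Os Ot e]]].
  (* Cubing 1 = p s + 3 t would make 1/3 an integer of K, against [wild_integers]. *)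
  have e3 : 1 = 3 * ((c%:~R - m%:~R * al * p) * s ^+ 3 + 3 * p ^+ 2 * s ^+ 2 * t
      + 9 * p * s * t ^+ 2 + 9 * t ^+ 3).
    transitivity ((p * s + 3 * t) ^+ 3); first by rewrite -e expr1n.
    by transitivity (p ^+ 3 * s ^+ 3 + 3 * (3 * p ^+ 2 * s ^+ 2 * t
      + 9 * p * s * t ^+ 2 + 9 * t ^+ 3)); [ring|rewrite p3; ring].
  have : O (in_alg K (1 / 3)).
    have -> : in_alg K (1 / 3) = (c%:~R - m%:~R * al * p) * s ^+ 3 + 3 * p ^+ 2 * s ^+ 2 * t
      + 9 * p * s * t ^+ 2 + 9 * t ^+ 3.
      rewrite -[LHS]mulr1 [X in _ * X]e3; set w := (_ + _ + _ + _).
      by transitivity (in_alg K (1 / 3 * 3) * w); [ring|rewrite mul1r mulVf// rmorph1 mul1r].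
    by integral.
  have [_ _ ->] := comb3_unit al be.
  move=> /(wild_integers pab (or_intror nm))[y0 [y1 [y2 ey]]].
  have [e0 _ _] := comb3_inj (pp_basis pab) ey.
  have : 1 = 3 * y0.
    by apply/eqP; rewrite -(eqr_int rat) rmorphM /= -e0.
  by lia.
have res x : O x -> exists i : int, P (x - i%:~R).
  move=> Ox; have [y0 [y1 [y2 ex]]] := wild_integers pab (or_intror nm) Ox.
  rewrite comb3_ratint in ex.
  have [k ek] := sqr_mod3 nb'.
  (* Modulo P, al is m, and be is b^2 be = b al^2 = b m^2 since b^2 is 1 modulo 3. *)
  exists (y0 + y1 * m + y2 * b%:Z * m ^+ 2).
  exists (y1%:~R + y2%:~R * b%:R * (al + m%:~R)), (- k%:~R * y2%:~R * be).
  split; [by integral|by integral|].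
  have bb : (b%:R : K) ^+ 2 = 1 + 3 * k%:~R.
    have := congr1 (fun z : int => z%:~R : K) ek.
    by rewrite rmorphXn rmorphD rmorphM /=.
  rewrite ex !(rmorphD, rmorphM, rmorphXn) /= -[(b%:~R)]/(b%:R).
  apply/eqP; rewrite -subr_eq0; apply/eqP.
  transitivity (y2%:~R * (1 + 3 * k%:~R - b%:R ^+ 2) * be - y2%:~R * b%:R * (al * al - b%:R * be)).
    by rewrite /p; ring.
  by rewrite bb (pp_alal pab) !subrr; ring.
exists P; split.
  split=> // x y Ox Oy Pxy.
  have [i Pi] := res _ Ox; have [j Pj] := res _ Oy.
  have Pij : P ((i * j)%:~R).
    have -> : (i * j)%:~R = x * y + (- x) * (y - j%:~R) + (- j%:~R) * (x - i%:~R).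
      by rewrite rmorphM /=; ring.
    by apply: (PD); [apply: (PD) => //|]; apply: (PM) => //; integral.
  have [[q eq]|nij] := pselect (exists q, i * j = 3 * q); last first.
    have [k ek] := sqr_mod3 nij; exfalso; apply: nP1.
    have -> : 1 = (i * j)%:~R * (i * j)%:~R + 3 * - k%:~R :> K.
      by rewrite -expr2 -rmorphXn ek rmorphD rmorphM rmorph1 /=; ring.
    by apply: (PD); [apply: (PM) => //; integral|apply: (P3); integral].
  case/three_divM: eq => [[q' eq']|[q' eq']]; [left|right].
    have -> : x = (x - i%:~R) + 3 * q'%:~R by rewrite eq' rmorphM /=; ring.
    by apply: (PD) => //; apply: (P3); integral.
  have -> : y = (y - j%:~R) + 3 * q'%:~R by rewrite eq' rmorphM /=; ring.
  by apply: (PD) => //; apply: (P3); integral.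
apply/seteqP; split=> [x [y Oy <-]|x].
  have [k ek] := sqr_mod3 nc.
  pose c6 : int := k + 3 * k ^+ 2 + 3 * k ^+ 3.
  have c6E : c%:~R ^+ 6 = 1 + 9 * c6%:~R :> K.
    have : c ^+ 6 = 1 + 9 * c6.
      by transitivity ((c ^+ 2) ^+ 3); [ring|rewrite ek /c6; ring].
    by move=> /(congr1 (fun z : int => z%:~R : K)); rewrite rmorphXn rmorphD rmorphM /=.
  (* Multiplying p^3 = 3 (c - m al p) by c + m al p gives 3 c^2 = p^3 (c + m al p) + 3 p^2 m^2 al^2.
     The factor c^4 turns the left side into 3 c^6 = 3 + 27 [c6], and p^3, 3 p^2 and 27 are products
     of three elements of P. *)
  have -> : 3 * y = p * p * (p * ((c%:~R + m%:~R * al * p) * c%:~R ^+ 4 * y))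
      + p * p * (3 * (m%:~R ^+ 2 * al ^+ 2 * c%:~R ^+ 4 * y))
      + 3 * 3 * (3 * (- c6%:~R * y)).
    symmetry.
    transitivity (p ^+ 3 * (c%:~R + m%:~R * al * p) * c%:~R ^+ 4 * y
        + 3 * p ^+ 2 * (m%:~R ^+ 2 * al ^+ 2 * c%:~R ^+ 4 * y)
        - 27 * c6%:~R * y); first by ring.
    rewrite p3.
    by transitivity (3 * (c%:~R ^+ 6 - 9 * c6%:~R) * y); [ring|rewrite c6E; ring].
  have PPp : ideal_mul P P (p * p).
    by apply: ideal_mul_in; rewrite -[p]mulr1; apply: (Pp).
  have PP3 : ideal_mul P P (3 * 3).
    by apply: ideal_mul_in; rewrite -[X in P X]mulr1; apply: (P3).
  apply: ideal_mulD; [apply: ideal_mulD|]; apply: ideal_mul_in => //.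
  - by apply: (Pp); integral.
  - by apply: (P3); integral.
  - by apply: (P3); integral.
pose T := [set 3%:R * x | x in O].
have T0 : T 0 by exists 0 => //; rewrite mulr0.
have TD x1 x2 : T x1 -> T x2 -> T (x1 + x2).
  by move=> [y1 O1' <-] [y2 O2' <-]; exists (y1 + y2); [integral|ring].
apply: (ideal_mul_sub (T := T)) => // u v PPu Pv.
apply: (@ideal_mul_sub _ P P (fun u => T (u * v))) PPu.
- by rewrite mul0r.
- by move=> ? ? ? ?; rewrite mulrDl; apply: TD.
- move=> _ _ [s1 [t1 [Os1 Ot1 ->]]] [s2 [t2 [Os2 Ot2 ->]]].
  have [s3 [t3 [Os3 Ot3 ->]]] := Pv.
  exists ((c%:~R - m%:~R * al * p) * s1 * s2 * s3 + p ^+ 2 * (s1 * s2 * t3 + s1 * t2 * s3 + t1 * s2 * s3)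
    + 3 * p * (s1 * t2 * t3 + t1 * s2 * t3 + t1 * t2 * s3) + 9 * t1 * t2 * t3).
    by integral.
  transitivity (p ^+ 3 * s1 * s2 * s3 + 3 * (p ^+ 2 * (s1 * s2 * t3 + s1 * t2 * s3 + t1 * s2 * s3)
    + 3 * p * (s1 * t2 * t3 + t1 * s2 * t3 + t1 * t2 * s3) + 9 * t1 * t2 * t3)); last by ring.
  by rewrite p3; ring.
Qed.

End Wild.

(** * Trace and embeddings *)

Lemma dedekind2 (K F : fieldType) (f g : {rmorphism K -> F}) (c d : F) :
  (exists x, f x != g x) -> (forall x, c * f x + d * g x = 0) -> c = 0 /\ d = 0.
Proof.
move=> [y ny] h.
have h1 : c + d = 0 by have := h 1; rewrite !rmorph1 !mulr1.
have d0 : d = - c by apply/eqP; rewrite -addr_eq0 addrC h1.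
have : c * (f y - g y) = 0 by rewrite -[RHS](h y) d0; ring.
move=> /eqP; rewrite mulf_eq0 subr_eq0 (negPf ny) orbF => /eqP c0.
by rewrite d0 c0 oppr0.
Qed.

(** Independence of characters: replacing x by w x and subtracting h(w) times the relation
    eliminates h. *)
Lemma dedekind3 (K F : fieldType) (f g h : {rmorphism K -> F}) (c d e : F) :
  (exists x, f x != g x) -> (exists x, f x != h x) -> (exists x, g x != h x) ->
  (forall x, c * f x + d * g x + e * h x = 0) -> [/\ c = 0, d = 0 & e = 0].
Proof.
move=> nfg [y nfh] [z ngh] H.
have H2 w x : (c * (f w - h w)) * f x + (d * (g w - h w)) * g x = 0.
  transitivity ((c * f (w * x) + d * g (w * x) + e * h (w * x))
     - h w * (c * f x + d * g x + e * h x)); first by rewrite !rmorphM; ring.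
  by rewrite !H mulr0 subr0.
have [/eqP + _] := dedekind2 nfg (H2 y); have [_ /eqP] := dedekind2 nfg (H2 z).
rewrite !mulf_eq0 !subr_eq0 (negPf nfh) (negPf ngh) !orbF => /eqP d0 /eqP c0.
by have := H 1; rewrite c0 d0 !rmorph1 !mul0r !add0r mulr1.
Qed.

Lemma rmorphZ_rat (K : fieldExtType rat) (F : numFieldType)
    (phi : {rmorphism K -> F}) (q : rat) (x : K) : phi (q *: x) = ratr q * phi x.
Proof. by rewrite -mulr_algl rmorphM -[q%:A]/(in_alg K q) rmorph_in_alg. Qed.

(* The three embeddings diagonalize the matrix of multiplication by x. *)
Lemma field_trace_sum (K : fieldExtType rat) (F : numFieldType)
    (f g h : {rmorphism K -> F}) (x : K) :
  \dim {:K} = 3%N ->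
  (exists x, f x != g x) -> (exists x, f x != h x) -> (exists x, g x != h x) ->
  ratr (field_trace x) = f x + g x + h x.
Proof.
move=> dimK nfg nfh ngh.
pose phi (i : 'I_3) : {rmorphism K -> F} :=
  if i == 0 then f else if i == 1 then g else h.
pose e := vbasis {:K}.
have eb : basis_of {:K} e := vbasisP _.
pose A := map_mx (ratr : rat -> F) (passmx.mxof e e (amull x)).
pose S := \matrix_(j < \dim {:K}, i < 3) phi i e`_j.
pose D := diag_mx (\row_(i < 3) phi i x).
have AS : A *m S = S *m D.
  apply/matrixP => j i; rewrite mul_mx_diag !mxE.
  rewrite mulrC -rmorphM /=.
  have -> : x * e`_j = \sum_k coord e k (x * e`_j) *: e`_k.
    by apply: coord_basis eb _; rewrite memvf.
  rewrite rmorph_sum; apply: eq_bigr => k _.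
  by rewrite !mxE /= passmx.vecof_delta lfunE /= rmorphZ_rat.
(* A vector in the kernel of S is a linear relation between the embeddings. *)
have ker (c : 'cV[F]_3) : S *m c = 0 -> c = 0.
  move=> Sc.
  have lin y : c 0 0 * f y + c 1 0 * g y + c 2 0 * h y = 0.
    rewrite (coord_basis eb (memvf y)).
    transitivity (\sum_k ratr (coord e k y) * (S *m c) k 0); last first.
      by rewrite Sc big1// => k _; rewrite mxE mulr0.
    rewrite !rmorph_sum !big_distrr /= -!big_split /=; apply: eq_bigr => k _.
    rewrite !rmorphZ_rat mxE !big_ord_recl big_ord0 !mxE /phi /=.
    have -> : lift ord0 (lift ord0 ord0) = 2 :> 'I_3 by apply/val_inj.
    have -> : lift ord0 ord0 = 1 :> 'I_3 by apply/val_inj.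
    by ring.
  have [c0 c1 c2] := dedekind3 nfg nfh ngh lin.
  apply/colP => i; rewrite mxE.
  case: i => -[|[|[|//]]] hi.
  - by rewrite -[RHS]c0; congr (c _ _); apply/val_inj.
  - by rewrite -[RHS]c1; congr (c _ _); apply/val_inj.
  - by rewrite -[RHS]c2; congr (c _ _); apply/val_inj.
have rf : row_free S^T.
  rewrite -kermx_eq0; apply/eqP/row_matrixP => i; rewrite row0.
  apply: trmx_inj; rewrite trmx0; apply: ker.
  by apply: trmx_inj; rewrite trmx_mul trmxK trmx0 -row_mul mulmx_ker row0.
(* S has [\dim {:K}] rows and 3 columns, equal only propositionally; a left and a right inverse are
   obtained separately and then identified. *)
have /row_freeP[B SB] := rf.
have /row_fullP[C CS] : row_full S^T.
  by move: rf; rewrite /row_free /row_full => /eqP->; rewrite dimK.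
pose T := B^T.
have TS : T *m S = 1%:M by rewrite -[S]trmxK -trmx_mul SB trmx1.
have ST : S *m T = 1%:M.
  have ST' : S *m C^T = 1%:M by rewrite -[S]trmxK -trmx_mul CS trmx1.
  by rewrite -[T]mulmx1 -ST' (mulmxA T) TS mul1mx.
have -> : ratr (field_trace x) = \tr A by rewrite /field_trace trace_map_mx.
rewrite -[A]mulmx1 -ST mulmxA AS mxtrace_mulC mulmxA TS mul1mx mxtrace_diag.
by rewrite !big_ord_recl big_ord0 !mxE addr0 addrA.
Qed.

Definition cubic_embeddings (R : realType) (K : fieldExtType rat)
    (f g h : {rmorphism K -> R[i]}) : Prop :=
  [/\ @embeddings R K = [set (f : K -> R[i]); (g : K -> R[i]); (h : K -> R[i])],
      forall x, complex.Im (f x) = 0, exists x, complex.Im (g x) != 0 &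
      forall x, h x = conjc (g x)].

Section CubicEmbeddings.
Variables (R : realType) (K : fieldExtType rat) (f g h : {rmorphism K -> R[i]}).
Hypothesis dimK : \dim {:K} = 3%N.
Hypothesis ce : cubic_embeddings f g h.

Lemma cubic_embeddings_neq :
  [/\ exists x, f x != g x, exists x, f x != h x & exists x, g x != h x].
Proof.
have [_ fr [x gx] hE] := ce; split; exists x.
- by apply: contraNneq gx => <-; rewrite fr.
- apply: contraNneq gx => e; have := fr x; rewrite e hE.
  by case: (g x) => u v /= /eqP; rewrite oppr_eq0.
- apply: contraNneq gx; rewrite hE; case: (g x) => u v /= [] /eqP.
  by rewrite -subr_eq0 opprK -mulr2n mulrn_eq0.
Qed.

Lemma cubic_trace x : ratr (field_trace x) = f x + g x + h x.
Proof. by have [? ? ?] := cubic_embeddings_neq; apply: field_trace_sum. Qed.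

Lemma ratr_complexRe (q : rat) : complex.Re (ratr q : R[i]) = ratr q.
Proof.
by rewrite -(fmorph_eq_rat (real_complex R \o ratr)).
Qed.

Lemma field_traceD (x y : K) : field_trace (x + y) = field_trace x + field_trace y.
Proof.
apply: (fmorph_inj (ratr : {rmorphism rat -> R[i]})).
by rewrite /= rmorphD /= !cubic_trace !rmorphD; ring.
Qed.

Lemma field_traceZ (q : rat) (x : K) : field_trace (q *: x) = q * field_trace x.
Proof.
apply: (fmorph_inj (ratr : {rmorphism rat -> R[i]})).
by rewrite /= rmorphM /= !cubic_trace !rmorphZ_rat; ring.
Qed.

Lemma field_traceZint (n : int) (x : K) : field_trace (x *~ n) = n%:~R * field_trace x.
Proof. by rewrite -scaler_int field_traceZ. Qed.

Lemma field_trace_alg (q : rat) : field_trace (q%:A : K) = 3 * q.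
Proof.
apply: (fmorph_inj (ratr : {rmorphism rat -> R[i]})).
by rewrite /= rmorphM /= !cubic_trace !rmorphZ_rat !rmorph1 rmorph_nat; ring.
Qed.

Lemma perpD (x y : K) : perp (x + y) = perp x + perp y.
Proof. by rewrite /perp field_traceD scalerDl; ring. Qed.

Lemma perpZint (n : int) (x : K) : perp (x *~ n) = perp x *~ n.
Proof.
rewrite /perp field_traceZint mulrzBl mulrzAr; congr (_ - _).
by rewrite -scalerA scaler_int.
Qed.

Lemma field_trace_perp (x : K) : field_trace (perp x) = 0.
Proof.
rewrite /perp (_ : 3%:R * x = 3%:Q *: x); last by rewrite scaler_int mulr_natl.
by rewrite -scaleN1r field_traceD 2!field_traceZ field_trace_alg; ring.
Qed.

(** With real conjugate u and complex conjugates v + iw, v - iw, the sum is u^2 + 2 v^2 + 2 w^2 and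
    Tr(x^2) = u^2 + 2 v^2 - 2 w^2. They add up to 2 u^2 + 4 v^2, which is 3 u^2 because trace zero
    means v = - u / 2. *)
Lemma minkowski_sum (x : K) : field_trace x = 0 ->
  \sum_(k \in @embeddings R K) Normc.normc (k x) ^+ 2 =
  3 * complex.Re (f x) ^+ 2 - ratr (field_trace (x ^+ 2)).
Proof.
have [eE fr gx hE] := ce; have [[y1 n1] [y2 n2] [y3 n3]] := cubic_embeddings_neq.
move=> tx; rewrite eE.
rewrite (fsbigE [:: (f : K -> R[i]); (g : K -> R[i]); (h : K -> R[i])]); last 3 first.
- rewrite /= !inE !negb_or !andbT; apply/andP; split; [apply/andP; split|].
  + by case: pselect => // e; exfalso; move: n1; rewrite e eqxx.
  + by case: pselect => // e; exfalso; move: n2; rewrite e eqxx.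
  + by case: pselect => // e; exfalso; move: n3; rewrite e eqxx.
- by move=> k; rewrite /= !inE => /or3P[]/eqP->; [left; left|left; right|right].
- by move=> k [[]|] ->; rewrite /= !inE eqxx ?orbT.
have := cubic_trace x; have := cubic_trace (x ^+ 2); rewrite tx rmorph0 !rmorphXn /= hE.
have := fr x; rewrite -ratr_complexRe.
move=> fx -> e.
rewrite !big_cons big_nil /= !ifT ?inE; last 3 first.
- by right.
- by left; right.
- by left; left.
rewrite hE; case: (f x) fx e => u u' /= ->; case: (g x) => v w [] e _ /=.
rewrite !sqr_sqrtr ?addr_ge0 ?sqr_ge0//.
have -> : v = - u / 2 by lra.
by field.
Qed.

Lemma minkowski_formE (a1 a2 : K) (x y : int) :
  @minkowski_form R K a1 a2 x y =
  3 * complex.Re (f (perp a1 *~ x + perp a2 *~ y)) ^+ 2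
   - ratr (field_trace ((perp a1 *~ x + perp a2 *~ y) ^+ 2)).
Proof.
apply: minkowski_sum.
by rewrite field_traceD !field_traceZint !field_trace_perp; ring.
Qed.

End CubicEmbeddings.

Lemma complex_cubic_embeddings (R : realType) (K : fieldExtType rat) :
  is_complex_cubic R K -> exists f g h : {rmorphism K -> R[i]}, cubic_embeddings f g h.
Proof.
move=> [_ /eq_cardSP[f [[f' ef] fr]]]; rewrite II0 card_eq0 => /eqP r0.
move=> /eq_cardSP[g [[g' eg] gnr]] /eq_cardSP[h [[[h' eh] hnr] hg]].
rewrite II0 card_eq0 => /eqP c0.
have emb k : @embeddings R K k -> k = f \/ k = g \/ k = h.
  move=> ek; have [kr|knr] := pselect (real_valued k).
    left; apply: contrapT => kf.
    by have : (set0 : set (K -> R[i])) k by rewrite -r0.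
  right; have [->|kg] := pselect (k = g); first by left.
  right; apply: contrapT => kh.
  by have : (set0 : set (K -> R[i])) k by rewrite -c0.
subst f g h.
have [x gx] : exists x, complex.Im (g' x) != 0.
  apply: contrapT => H; apply: gnr => x /=; apply/eqP/negPn/negP => H2.
  by apply: H; exists x.
exists f', g', h'; split=> //; last first.
(* The conjugate of g' is an embedding that is neither real nor equal to g', so it is the remaining
   one. *)
- pose k : {rmorphism K -> R[i]} := conjc \o g'.
  have : @embeddings R K k by exists k.
  move=> /emb[|[|]] e y.
  + have := fr x; rewrite -e /k /=; case: (g' x) gx => u v /= + /eqP.
    by rewrite oppr_eq0 => /negPf->.
  + have := congr1 (fun f => complex.Im (f x)) e; rewrite /k /=.
    case: (g' x) gx => u v /= v0 /eqP.
    by rewrite -subr_eq0 -opprD oppr_eq0 -mulr2n mulrn_eq0 (negPf v0).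
  + by rewrite -e.
- by exists x.
- apply/seteqP; split=> k.
    by move=> /emb[->|[->|->]]; [left; left|left; right|right].
  by move=> [[]|] ->; [exists f'|exists g'|exists h'].
Qed.

Lemma embeddings_complex_cubic (R : realType) (K : fieldExtType rat)
    (f g h : {rmorphism K -> R[i]}) :
  \dim {:K} = 3%N -> cubic_embeddings f g h -> is_complex_cubic R K.
Proof.
move=> dimK ce; have [eE fr [x gx] hE] := ce.
have [[y1 n1] [y2 n2] [y3 n3]] := cubic_embeddings_neq ce.
have gnr : ~ real_valued (g : K -> R[i]) by move=> /(_ x) /eqP; rewrite (negPf gx).
have hnr : ~ real_valued (h : K -> R[i]).
  move=> /(_ x) /eqP; rewrite hE; case: (g x) gx => u v /= v0.
  by rewrite oppr_eq0 (negPf v0).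
split=> //.
  rewrite (_ : _ `&` _ = [set (f : K -> R[i])]); first exact: card_set1.
  apply/seteqP; split=> k; rewrite eE.
    by move=> [[[]|] -> ].
  by move=> ->; split; [left; left|].
apply/eq_cardSP; exists (g : K -> R[i]).
  by split=> //; rewrite eE; left; right.
rewrite (_ : _ `\` _ = [set (h : K -> R[i])]); first exact: card_set1.
apply/seteqP; split=> k; rewrite eE.
  by move=> [[[[->|->]|->] nr] ng]; [case: nr|case: ng|].
move=> ->; split; first by split=> //; right.
by move=> e; move: n3; rewrite -[h y3]/((h : K -> R[i]) y3) e eqxx.
Qed.

(** * The Gauss domain and reduced bases *)

(** The norm of [R[i]] takes values in [R[i]], so the radius of a ball is a complex number with zero
    imaginary part; square boxes with a real side avoid it. *)
Lemma nbhs_complexP (R : realType) (z : R[i] : numFieldType) (A : set (R[i] : numFieldType)) :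
  nbhs z A <-> exists2 e : R, 0 < e & forall w : R[i],
    `|complex.Re w - complex.Re z| < e -> `|complex.Im w - complex.Im z| < e -> A w.
Proof.
split.
  move=> /nbhs_ballP[[e e'] /=]; rewrite ltcE /= => /andP[/eqP-> e0] H.
  exists (e / 2); first by rewrite divr_gt0.
  move=> w hRe hIm; apply: H; rewrite /ball /= normc_def ltcR.
  have -> : complex.Re (z - w) = complex.Re z - complex.Re w by case: (z) (w) => ? ? [].
  have -> : complex.Im (z - w) = complex.Im z - complex.Im w by case: (z) (w) => ? ? [].
  rewrite distrC in hRe; rewrite distrC in hIm.
  set p := complex.Re z - _ in hRe *; set q := complex.Im z - _ in hIm *.
  rewrite -(ger0_norm (ltW e0)) -sqrtr_sqr ltr_sqrt ?exprn_gt0//.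
  rewrite -[p ^+ 2]real_normK ?num_real// -[q ^+ 2]real_normK ?num_real//.
  have := normr_ge0 p; have := normr_ge0 q; nra.
move=> [e e0 H]; apply/nbhs_ballP; exists (real_complex R e); first by rewrite /= ltcR.
move=> w; rewrite /ball /= normc_def ltcR => hw.
have hb (p q : R) : Num.sqrt (p ^+ 2 + q ^+ 2) < e -> `|p| < e.
  apply: le_lt_trans; rewrite -sqrtr_sqr ler_sqrt ?addr_ge0 ?sqr_ge0//.
  by rewrite lerDl sqr_ge0.
have eRe : complex.Re (z - w) = complex.Re z - complex.Re w by case: (z) (w) => ? ? [].
have eIm : complex.Im (z - w) = complex.Im z - complex.Im w by case: (z) (w) => ? ? [].
rewrite eRe eIm in hw; apply: H; rewrite distrC.
  exact: hb hw.
by rewrite addrC in hw; exact: hb hw.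
Qed.

Lemma gauss_domain_interior (R : realType) (z : R[i] : numFieldType) :
  gauss_domain z -> 0 < complex.Re z < 2^-1 ->
  1 < complex.Re z ^+ 2 + complex.Im z ^+ 2 -> interior (@gauss_domain R) z.
Proof.
move=> [y0 _ _]; set x := complex.Re z; set y := complex.Im z in y0 *.
move=> /andP[x0 x2] n1; apply/nbhs_complexP.
have xy : 0 < 2 * (x + y) by lra.
(* Moving both coordinates by less than e lowers x^2 + y^2 by at most 2 e (x + y). *)
pose e3 := (x ^+ 2 + y ^+ 2 - 1) / (2 * (x + y)).
have e30 : 0 < e3 by rewrite divr_gt0// subr_gt0.
have e3E : e3 * (2 * (x + y)) = x ^+ 2 + y ^+ 2 - 1 by rewrite divfK// gt_eqF.
pose e := Num.min (Num.min x (2^-1 - x)) (Num.min y e3).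
have [ex ex2 ey ee3] : [/\ e <= x, e <= 2^-1 - x, e <= y & e <= e3].
  by rewrite /e !ge_min !lexx !orbT.
have e0 : 0 < e by rewrite /e !lt_min x0 y0 e30 subr_gt0 x2.
exists e => // w; rewrite !ltr_norml -/x -/y; set x' := complex.Re w; set y' := complex.Im w.
move=> /andP[h1 h2] /andP[h3 h4]; split; rewrite -?/x' -?/y'.
- by lra.
- by apply/andP; split; lra.
- have : (x - e) ^+ 2 <= x' ^+ 2 by rewrite ler_sqr ?nnegrE; lra.
  have : (y - e) ^+ 2 <= y' ^+ 2 by rewrite ler_sqr ?nnegrE; lra.
  have : e * (2 * (x + y)) <= e3 * (2 * (x + y)) by rewrite ler_pM2r.
  by nra.
Qed.

Lemma gauss_domain_boundary (R : realType) (z : R[i] : numFieldType) :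
  gauss_domain z ->
  [\/ complex.Re z = 0, complex.Re z = 2^-1 | complex.Re z ^+ 2 + complex.Im z ^+ 2 = 1] ->
  boundary (@gauss_domain R) z.
Proof.
move=> gz h; split; first exact: subset_closure.
move=> /nbhs_complexP[e e0 H]; have [y0 _ _] := gz.
have H' (p q : R) : `|p| < e -> `|q| < e ->
    gauss_domain (Complex (complex.Re z + p) (complex.Im z + q)).
  by move=> hp hq; apply: H; rewrite /= addrAC subrr add0r.
have e2 : `|e / 2| < e by rewrite ger0_norm; lra.
have n0 : `|0 : R| < e by rewrite normr0.
case: h => h.
- have e2' : `|- (e / 2)| < e by rewrite normrN.
  by have [_ /= /andP[+ _] _] := H' _ 0 e2' n0; rewrite h; lra.
- by have [_ /= /andP[_ +] _] := H' _ 0 e2 n0; rewrite h; lra.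
(* On the circle one moves straight down; d < Im z keeps the point in the upper half-plane, so its
   modulus drops below 1. *)
- set d := Num.min e (complex.Im z) / 2.
  have d0 : 0 < d by rewrite divr_gt0// lt_min e0.
  have de : d < e by rewrite /d; have : Num.min e (complex.Im z) <= e; [rewrite ge_min lexx|lra].
  have dy : d < complex.Im z.
    by rewrite /d; have : Num.min e (complex.Im z) <= complex.Im z; [rewrite ge_min lexx orbT|lra].
  have de' : `|- d| < e by rewrite normrN ger0_norm ?ltW.
  by have [_ _ /=] := H' 0 _ n0 de'; rewrite addr0; nra.
Qed.

(** Excludes the default value of [field_shape], so a shape on the boundary is a genuine point of
    [shape_points]. *)
Lemma boundary0 (R : realType) : ~ boundary (@gauss_domain R) 0.
Proof.
move=> [/(_ [set w : R[i] | `|complex.Re w| < 2^-1 /\ `|complex.Im w| < 2^-1]) + _].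
case.
  by apply/nbhs_complexP; exists 2^-1; rewrite ?invr_gt0// => w; rewrite /= !subr0.
move=> w [[_ _ h] [/= hx hy]].
rewrite !ltr_norml in hx hy; have /andP[? ?] := hx; have /andP[? ?] := hy; nra.
Qed.

Lemma boundary_cases (R : realType) (z : R[i] : numFieldType) :
  gauss_domain z -> boundary (@gauss_domain R) z ->
  [\/ complex.Re z = 0, complex.Re z = 2^-1 | complex.Re z ^+ 2 + complex.Im z ^+ 2 = 1].
Proof.
move=> gz [_ ni]; have [_ /andP[x0 x2] n1] := gz.
have [->|x0'] := eqVneq (complex.Re z) 0; first by constructor 1.
have [->|x2'] := eqVneq (complex.Re z) 2^-1; first by constructor 2.
have [->|n1'] := eqVneq (complex.Re z ^+ 2 + complex.Im z ^+ 2) 1; first by constructor 3.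
exfalso; apply: ni; apply: gauss_domain_interior => //.
  by rewrite !lt_neqAle x0 x2 x2' eq_sym x0'.
by rewrite lt_neqAle n1 eq_sym n1'.
Qed.

(** * The action of GL2(Z) on roots and on binary quadratic forms *)

Lemma det_mx2 (A : comPzRingType) (g : 'M[A]_2) :
  \det g = g 0 0 * g 1 1 - g 0 1 * g 1 0.
Proof.
rewrite (expand_det_row _ 0) !big_ord_recl big_ord0 addr0 /cofactor !det_mx11 !mxE /=.
rewrite expr0 expr1.
have -> : lift 0 0 = 1 :> 'I_2 by apply/val_inj.
have -> : lift 1 0 = 0 :> 'I_2 by apply/val_inj.
by ring.
Qed.

Lemma det_unit_int (n : nat) (g : 'M[int]_n) : g \in unitmx -> \det g = 1 \/ \det g = -1.
Proof.
move=> gu; have : \det g * \det (invmx g) = 1 by rewrite -det_mulmx mulmxV// det1.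
set x := \det g; set y := \det _ => /(congr1 absz); rewrite abszM => /eqP.
by rewrite muln_eq1 => /andP[/eqP + _]; lia.
Qed.

Lemma complex_div (R : realType) (A B C D : R) :
  Complex A B / Complex C D =
  Complex ((A * C + B * D) / (C ^+ 2 + D ^+ 2)) ((B * C - A * D) / (C ^+ 2 + D ^+ 2)).
Proof.
have -> : (Complex C D)^-1 = Complex (C / (C ^+ 2 + D ^+ 2)) (- (D / (C ^+ 2 + D ^+ 2))) by [].
by apply/eqP; rewrite eq_complex /=; apply/andP; split; apply/eqP; ring.
Qed.

(** If w is the root or its conjugate, the form is r |x + w y|^2. The substitution gives r |(c w +
    d) x + (a w + b) y|^2 = r |c w + d|^2 |x + z y|^2, so r' = r |c w + d|^2. That r is positive and
    the discriminant has the right sign follows from Im z > 0. *)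
Lemma GL2Z_act_form (R : realType) (g : 'M[int]_2) (r s t : R) (z : R[i]) :
  g \in unitmx -> z = GL2Z_act g (form_root r s t) -> 0 < complex.Im z ->
  let a : R := (g 0 0)%:~R in let b : R := (g 0 1)%:~R in
  let c : R := (g 1 0)%:~R in let d : R := (g 1 1)%:~R in
  exists2 r' : R, 0 < r' & forall x y : R,
    r * (d * x + b * y) ^+ 2 + s * (d * x + b * y) * (c * x + a * y) +
      t * (c * x + a * y) ^+ 2 =
    r' * (x ^+ 2 + 2 * complex.Re z * x * y +
          (complex.Re z ^+ 2 + complex.Im z ^+ 2) * y ^+ 2).
Proof.
move=> gu ez z0 a b c d.
have detE : (\det g)%:~R = a * d - b * c.
  by rewrite det_mx2 rmorphB !rmorphM.
have dg := det_unit_int gu.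
set p := s / (2 * r); set q := Num.sqrt (4 * r * t - s ^+ 2) / (2 * r).
have eint (n : int) : (n%:~R : R[i]) = Complex n%:~R 0.
  by rewrite -(rmorph_int (real_complex R)).
(* The imaginary part of w: the sign of the determinant accounts for the conjugation. *)
pose q' := (\det g)%:~R * q.
have ewE : z = (Complex a 0 * Complex p q' + Complex b 0) / (Complex c 0 * Complex p q' + Complex d 0).
  rewrite ez /GL2Z_act !eint /form_root -/p -/q /q'.
  by case: dg => -> /=; rewrite ?mul1r ?mulN1r.
pose n := (c * p + d) ^+ 2 + (c * q') ^+ 2.
have [reE imE] : complex.Re z = ((a * p + b) * (c * p + d) + a * c * q' ^+ 2) / n /\
    complex.Im z = (a * d - b * c) * q' / n.
  rewrite ewE.
  have -> : Complex a 0 * Complex p q' + Complex b 0 = Complex (a * p + b) (a * q').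
    by apply/eqP; rewrite eq_complex /=; apply/andP; split; apply/eqP; ring.
  have -> : Complex c 0 * Complex p q' + Complex d 0 = Complex (c * p + d) (c * q').
    by apply/eqP; rewrite eq_complex /=; apply/andP; split; apply/eqP; ring.
  by rewrite complex_div /= -/n; split; congr (_ / _); ring.
have q2 : q' ^+ 2 = q ^+ 2 by rewrite /q'; case: dg => ->; ring.
have n0 : 0 <= n by rewrite addr_ge0 ?sqr_ge0.
have np : 0 < n.
  rewrite lt_neqAle n0 andbT; apply: contraTneq z0 => n00.
  by rewrite imE -n00 invr0 mulr0 ltxx.
have q0 : 0 < q.
  have : 0 < q / n by rewrite -[q]mul1r; move: z0; rewrite imE -detE /q'; case: dg => -> /=; rewrite ?mulrNz ?mulN1r ?mulrN ?mulNr ?opprK ?mul1r.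
  by rewrite pmulr_lgt0 ?invr_gt0.
have r0 : 0 < r.
  rewrite ltNge; apply/negP => r0.
  have : q <= 0 by rewrite /q mulr_ge0_le0 ?sqrtr_ge0// invr_le0; lra.
  by lra.
have D0 : 0 <= 4 * r * t - s ^+ 2.
  rewrite leNgt; apply/negP => D0; move: q0.
  by rewrite /q ler0_sqrtr ?ltW// mul0r ltxx.
have rn : r != 0 by rewrite gt_eqF.
have sE : s = 2 * r * p by rewrite /p; field.
have tE : t = r * (p ^+ 2 + q' ^+ 2).
  have -> : q' ^+ 2 = (4 * r * t - s ^+ 2) / (2 * r) ^+ 2.
    by rewrite q2 /q expr_div_n sqr_sqrtr.
  by rewrite /p; field.
exists (r * n); first by rewrite mulr_gt0.
move=> x y; rewrite reE imE tE sE.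
have nn : n != 0 by rewrite gt_eqF.
have -> : (((a * p + b) * (c * p + d) + a * c * q' ^+ 2) / n) ^+ 2 +
    ((a * d - b * c) * q' / n) ^+ 2 = ((a * p + b) ^+ 2 + a ^+ 2 * q' ^+ 2) / n.
  by rewrite /n in nn *; field.
transitivity (r * (n * x ^+ 2 + 2 * ((a * p + b) * (c * p + d) + a * c * q' ^+ 2) * x * y +
   ((a * p + b) ^+ 2 + a ^+ 2 * q' ^+ 2) * y ^+ 2)); last by field.
by rewrite /n; ring.
Qed.

Lemma mulrz_comb (V : zmodType) (u v : V) (a b c d x y : int) :
  (u *~ d + v *~ c) *~ x + (u *~ b + v *~ a) *~ y =
  u *~ (d * x + b * y) + v *~ (c * x + a * y).
Proof. by rewrite !mulrzDl !mulrzDr -!mulrzA addrACA. Qed.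

(** The determinant e is its own inverse, so e times the adjugate is the inverse change of basis. *)
Lemma integral_basis_change (K : fieldExtType rat) (a1 a2 : K) (a b c d e : int) :
  e * e = 1 -> a * d - b * c = e -> is_integral_basis a1 a2 ->
  is_integral_basis (a1 *~ d + a2 *~ c) (a1 *~ b + a2 *~ a).
Proof.
move=> ee de [gen fr].
have E (c0 n1 n2 : int) : c0%:~R + (a1 *~ d + a2 *~ c) *~ n1 + (a1 *~ b + a2 *~ a) *~ n2 =
    c0%:~R + a1 *~ (d * n1 + b * n2) + a2 *~ (c * n1 + a * n2) :> K.
  by rewrite -!addrA mulrz_comb.
have inv1 (c1 c2 : int) : d * (e * (a * c1 - b * c2)) + b * (e * (d * c2 - c * c1)) = c1.
  by transitivity (e * (a * d - b * c) * c1); [ring|rewrite de ee mul1r].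
have inv2 (c1 c2 : int) : c * (e * (a * c1 - b * c2)) + a * (e * (d * c2 - c * c1)) = c2.
  by transitivity (e * (a * d - b * c) * c2); [ring|rewrite de ee mul1r].
split=> [x|c0 n1 n2]; last first.
  rewrite E => /fr[-> h1 h2]; split=> //.
    transitivity (e * (a * (d * n1 + b * n2) - b * (c * n1 + a * n2))).
      by transitivity (e * (a * d - b * c) * n1); [rewrite de ee mul1r|ring].
    by rewrite h1 h2; ring.
  transitivity (e * (d * (c * n1 + a * n2) - c * (d * n1 + b * n2))).
    by transitivity (e * (a * d - b * c) * n2); [rewrite de ee mul1r|ring].
  by rewrite h1 h2; ring.
rewrite gen; split=> -[c0 [c1 [c2 ->]]].
  exists c0, (e * (a * c1 - b * c2)), (e * (d * c2 - c * c1)).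
  by rewrite E inv1 inv2.
by rewrite E; do 3 eexists.
Qed.

(** The matrix g is absorbed into the basis, so that z itself is the root of the form. *)
Lemma shape_reduced (R : realType) (K : fieldExtType rat)
    (f g h : {rmorphism K -> R[i]}) (z : R[i]) :
  \dim {:K} = 3%N -> cubic_embeddings f g h -> @shape_points R K z ->
  exists a1 a2 : K, is_integral_basis a1 a2 /\
  exists2 r : R, 0 < r & forall x y : int,
    @minkowski_form R K a1 a2 x y =
    r * (x%:~R ^+ 2 + 2 * complex.Re z * x%:~R * y%:~R +
         (complex.Re z ^+ 2 + complex.Im z ^+ 2) * y%:~R ^+ 2).
Proof.
move=> dimK ce [gz [a1 [a2 [r [s [t [ib M [m mu ez]]]]]]]].
have [z0 _ _] := gz; have [r' r0 H] := GL2Z_act_form mu ez z0.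
exists (a1 *~ m 1 1 + a2 *~ m 1 0), (a1 *~ m 0 1 + a2 *~ m 0 0); split.
  apply: (@integral_basis_change _ _ _ _ _ _ _ (\det m)) => //.
    by case: (det_unit_int mu) => ->.
  by rewrite det_mx2; ring.
exists r' => // x y.
rewrite -H -!rmorphM -!rmorphD -M /minkowski_form.
by rewrite !(perpD dimK ce, perpZint dimK ce) mulrz_comb.
Qed.

(** * The shape of a wild pure cubic field *)

Lemma basis3_dim (K : fieldExtType rat) (u v : K) : basis3 u v -> \dim {:K} = 3%N.
Proof.
move=> [sp fr].
have comb x0 x1 x2 : comb3 u v x0 x1 x2 = x0 *: 1 + x1 *: u + x2 *: v.
  by rewrite /comb3 /= !mulr_algl.
have b : basis_of {:K} [:: 1; u; v].
  rewrite basisEfree; apply/and3P; split.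
  - apply/(freeP (n := 3) (X := [tuple 1; u; v])) => k.
    rewrite !big_ord_recl big_ord0 /= addr0 => h.
    have := fr (k 0) (k (lift ord0 ord0)) (k (lift ord0 (lift ord0 ord0))).
    rewrite comb -addrA => /(_ h)[k0 k1 k2] i.
    case: i => -[|[|[|//]]] hi.
    + by rewrite -[RHS]k0; congr (k _); apply/val_inj.
    + by rewrite -[RHS]k1; congr (k _); apply/val_inj.
    + by rewrite -[RHS]k2; congr (k _); apply/val_inj.
  - exact: subvf.
  - suff -> : {:K}%VS = span [:: 1 : K; u; v] by exact: dim_span.
    apply/eqP; rewrite eq_sym eqEsubv subvf /=; apply/subvP => x _.
    have [x0 [x1 [x2 ->]]] := sp x; rewrite comb.
    by rewrite !rpredD// rpredZ// memv_span// !inE eqxx ?orbT.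
by rewrite -(size_basis (X := [tuple 1; u; v]) b).
Qed.

Section PureTrace.
Variables (K : fieldExtType rat) (a b : nat) (al be : K).
Hypothesis pab : pure_pair a b al be.

Lemma pure_field_trace x0 x1 x2 : field_trace (comb3 al be x0 x1 x2) = 3 * x0.
Proof.
have [r1 [r2 [z [h1 h2 h3 hz]]]] := pure_pair_algC pab.
have [phi [psi [chi [[p1 p2] [q1 q2] [s1 s2]]]]] := pure_pair_rmorph3 pab h1 h2 h3 hz.
have r0 : r1 != 0.
  apply/eqP => r0; move: h3; rewrite r0 mul0r => /esym/eqP.
  by rewrite mulf_eq0 !pnatr_eq0 !eqn0Ngt (pp_a0 pab) (pp_b0 pab).
have z1 : z != 1.
  apply/eqP => z1; move: hz; rewrite z1 => /eqP.
  by rewrite (_ : 1 ^+ 2 + 1 + 1 = 3%:R) ?pnatr_eq0//; ring.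
have z0 : z != 0.
  by apply/eqP => z0; move: hz => /eqP; rewrite z0 expr0n /= !add0r oner_eq0.
apply: (fmorph_inj (ratr : {rmorphism rat -> algC})).
rewrite /= (@field_trace_sum _ _ phi psi chi) ?(basis3_dim (pp_basis pab))//.
- rewrite !rmorph_comb3 p1 p2 q1 q2 s1 s2 rmorphM /= rmorph_nat.
  transitivity (3 * ratr x0 + (z ^+ 2 + z + 1) * (ratr x1 * r1 + ratr x2 * r2)); first by ring.
  by rewrite hz mul0r addr0.
- exists al; rewrite p1 q1 eq_sym -subr_eq0 (_ : _ - _ = (z - 1) * r1); last by ring.
  by rewrite mulf_neq0// subr_eq0.
- exists al; rewrite p1 s1 eq_sym -subr_eq0 (_ : _ - _ = (z - 1) * (z + 1) * r1); last by ring.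
  rewrite !mulf_neq0// ?subr_eq0//.
  have -> : z + 1 = - z ^+ 2 by apply/eqP; rewrite -addr_eq0 addrC addrA hz.
  by rewrite oppr_eq0 expf_neq0.
- exists al; rewrite q1 s1 eq_sym -subr_eq0 (_ : _ - _ = z * (z - 1) * r1); last by ring.
  by rewrite !mulf_neq0// subr_eq0.
Qed.

Lemma pure_perp x0 x1 x2 : perp (comb3 al be x0 x1 x2) = comb3 al be 0 (3 * x1) (3 * x2).
Proof.
rewrite /perp pure_field_trace -[_%:A]/(in_alg K _).
by rewrite /comb3 !rmorphM !rmorph_nat rmorph0; ring.
Qed.

End PureTrace.

(** The second minimum of a reduced form is t. For P = |p| and Q = |q| the value is at least r P^2 -
    r P Q + t Q^2. If P >= Q, drop r P (P - Q); otherwise replace r by t in the negative part,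
    leaving t ((Q - P)^2 + P Q). *)
Lemma reduced_min (R : realType) (r s t : R) (p q : int) : 0 < s < r -> r < t -> q != 0 ->
  t <= r * p%:~R ^+ 2 + s * p%:~R * q%:~R + t * q%:~R ^+ 2.
Proof.
move=> /andP[s0 sr] rt q0.
pose P : R := `|p|%:~R; pose Q : R := `|q|%:~R.
have eP : p%:~R ^+ 2 = P ^+ 2 by rewrite /P intr_norm real_normK ?num_real.
have eQ : q%:~R ^+ 2 = Q ^+ 2 by rewrite /Q intr_norm real_normK ?num_real.
have P0 : 0 <= P by rewrite /P intr_norm.
have Q1 : 1 <= Q by rewrite /Q -[1]/(1%:~R) ler_int -gtz0_ge1 normr_gt0.
have pq : - (P * Q) <= p%:~R * q%:~R by rewrite /P /Q !intr_norm -normrM lerNl ler_normr lexx orbT.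
have spq : - (r * (P * Q)) <= s * p%:~R * q%:~R.
  rewrite -mulrA; have [h|h] := leP 0 (p%:~R * q%:~R : R).
    have : 0 <= s * (p%:~R * q%:~R) by rewrite mulr_ge0// ltW.
    have : 0 <= r * (P * Q) by rewrite !mulr_ge0//; lra.
    by lra.
  have : s * (P * Q) <= r * (P * Q) by rewrite ler_wpM2r ?mulr_ge0//; lra.
  have : s * - (P * Q) <= s * (p%:~R * q%:~R) by rewrite ler_wpM2l// ltW.
  by lra.
rewrite eP eQ.
have [QP|PQ] := leP Q P.
  have : 0 <= r * (P * (P - Q)) by rewrite !mulr_ge0//; lra.
  have : t * 1 <= t * Q ^+ 2 by rewrite ler_wpM2l; [|lra|]; nra.
  by lra.
have PQ1 : P + 1 <= Q.
  move: PQ; rewrite /P /Q ltr_int -[1]/(1%:~R) -rmorphD ler_int /=; lia.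
have : 0 <= (t - r) * (P * (Q - P)) by rewrite !mulr_ge0//; lra.
have : t * 1 <= t * ((Q - P) ^+ 2 + P * Q) by rewrite ler_wpM2l; [|lra|]; nra.
by lra.
Qed.

Lemma int_unit_sqr (x y : int) : x * y = 1 -> x ^+ 2 = 1.
Proof.
move=> /(congr1 absz); rewrite abszM => /eqP; rewrite muln_eq1 => /andP[/eqP h _].
by have [->|->] : x = 1 \/ x = -1 by lia.
Qed.

(** Here (p, q) and (p', q') are the two orthogonal axis vectors in the reduced basis, of values A
    and B. If q = 0, the first basis vector is the first axis up to sign. If not, r < t <= A by
    [reduced_min] forces u = 0, and it is the second axis. In both cases s is an even multiple of r,
    against 0 < s < r. *)
Lemma reduced_diagonal (R : realType) (A B r s t : R) (u v u' v' p q p' q' : int) :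
  0 < A -> 0 < B -> 0 < s < r -> r < t ->
  (forall x y : int, A * (u * x + u' * y)%:~R ^+ 2 + B * (v * x + v' * y)%:~R ^+ 2 =
     r * x%:~R ^+ 2 + s * x%:~R * y%:~R + t * y%:~R ^+ 2) ->
  p * u + q * u' = 1 -> p * v + q * v' = 0 -> p' * u + q' * u' = 0 -> p' * v + q' * v' = 1 ->
  False.
Proof.
move=> A0 B0 sr rt H e1 e2 e3 e4.
have half (C : R) (w : int) : 0 < C -> 0 < 2 * C * w%:~R < C -> False.
  move=> C0 /andP[h1 h2].
  have [w0|w0] := leP w 0.
    have : w%:~R <= 0 :> R by rewrite lerz0.
    by nra.
  have : 1 <= w%:~R :> R by rewrite -[1]/(1%:~R) ler_int -gtz0_ge1.
  by nra.
have rE : r = A * u%:~R ^+ 2 + B * v%:~R ^+ 2.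
  have := H 1 0; rewrite !mulr1 !mulr0 !addr0 => ->; rewrite rmorph1 rmorph0; ring.
have sE : s = 2 * (A * (u * u')%:~R + B * (v * v')%:~R).
  have := H 1 1; have := H 0 1; rewrite !mulr1 !mulr0 !add0r !rmorphD !rmorphM rmorph1 rmorph0 /=.
  by lra.
have [q0|q0] := eqVneq q 0.
  have pu : u * p = 1 by rewrite -e1 q0; ring.
  have v0 : v = 0.
    have : p * v = 0 by rewrite -e2 q0; ring.
    move=> /eqP; rewrite mulf_eq0 => /orP[/eqP p0|/eqP//].
    by move: pu; rewrite p0 mulr0.
  have rA : r = A by rewrite rE v0 -rmorphXn (int_unit_sqr pu) rmorph1 rmorph0; ring.
  have sA : s = 2 * A * (u * u')%:~R by rewrite sE v0 mul0r rmorph0; ring.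
  by apply: (half A (u * u')) => //; move: sr; rewrite sA rA.
have tA : t <= A.
  have := reduced_min p sr rt q0; rewrite -H (_ : u * p + u' * q = 1); last by rewrite -e1; ring.
  rewrite (_ : v * p + v' * q = 0); last by rewrite -e2; ring.
  by rewrite rmorph1 rmorph0 expr1n expr0n /= mulr0 mulr1 addr0.
have u0 : u = 0.
  apply/eqP; apply: contraT => u0.
  have : (1 : R) <= u%:~R ^+ 2.
    by rewrite -rmorphXn -[1]/(1%:~R) ler_int; have : 0 < u ^+ 2; [rewrite exprn_even_gt0|lia].
  have : (0 : R) <= B * v%:~R ^+ 2 by rewrite mulr_ge0 ?sqr_ge0// ltW.
  by nra.
have qu : q * u' = 1 by rewrite -e1 u0; ring.
have q'0 : q' = 0.
  have : q' * u' = 0 by rewrite -e3 u0; ring.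
  move=> /eqP; rewrite mulf_eq0 => /orP[/eqP//|/eqP p0].
  by move: qu; rewrite p0 mulr0.
have pv : v * p' = 1 by rewrite -e4 q'0; ring.
have rB : r = B by rewrite rE u0 -[v%:~R ^+ 2]rmorphXn (int_unit_sqr pv) rmorph1 rmorph0; ring.
have sB : s = 2 * B * (v * v')%:~R by rewrite sE u0 mul0r rmorph0; ring.
by apply: (half B (v * v')) => //; move: sr; rewrite sB rB.
Qed.

Lemma comb3_mulrz (K : fieldExtType rat) (u v : K) (x0 x1 x2 : rat) (n : int) :
  comb3 u v x0 x1 x2 *~ n = comb3 u v (n%:~R * x0) (n%:~R * x1) (n%:~R * x2).
Proof. by rewrite -scaler_int -mulr_algl -[_%:A]/(in_alg K _) comb3Z. Qed.

Lemma real_cube_root (R : realType) (x : R) : 0 < x -> exists2 y : R, 0 < y & y ^+ 3 = x.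
Proof.
move=> x0; exists (x `^ 3^-1); first exact: powR_gt0.
by rewrite -powR_mulrn ?powR_ge0// -powRrM mulVf// powRr1// ltW.
Qed.

(** * The Minkowski form of a pure cubic field is diagonal *)

Section PureShape.
Variables (R : realType) (K : fieldExtType rat) (a b : nat) (al be : K).
Hypothesis pab : pure_pair a b al be.

Lemma pure_rmorph_ext (F : numFieldType) (phi psi : {rmorphism K -> F}) :
  phi al = psi al -> phi = psi :> (K -> F).
Proof.
move=> e; apply: funext => x; have [x0 [x1 [x2 ->]]] := (pp_basis pab).1 x.
rewrite !rmorph_comb3 e; congr (_ + _ * _).
have bn0 : b%:R != 0 :> F by rewrite pnatr_eq0 -lt0n (pp_b0 pab).
have E (k : {rmorphism K -> F}) : b%:R * k be = k al * k al.
  by rewrite -rmorphM (pp_alal pab) rmorphM rmorph_nat.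
by apply: (mulfI bn0); rewrite !E e.
Qed.

Lemma pure_cubic_embeddings : exists (rho1 rho2 : R) (f g h : {rmorphism K -> R[i]}),
  [/\ 0 < rho1 /\ 0 < rho2, rho1 * rho2 = a%:R * b%:R,
      f al = Complex rho1 0, f be = Complex rho2 0 & cubic_embeddings f g h].
Proof.
have a0 : (0 : R) < a%:R by rewrite ltr0n (pp_a0 pab).
have b0 : (0 : R) < b%:R by rewrite ltr0n (pp_b0 pab).
have bn0 : b%:R != 0 :> R by rewrite gt_eqF.
have [r1 r10 r13] := real_cube_root (mulr_gt0 a0 (exprn_gt0 2 b0)).
pose r2 := r1 ^+ 2 / b%:R.
have r20 : 0 < r2 by rewrite divr_gt0// exprn_gt0.
have h1 : r1 * r1 = b%:R * r2 by rewrite /r2; field.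
have h2 : r2 * r2 = a%:R * r1.
  have -> : r2 * r2 = r1 ^+ 3 * r1 / b%:R ^+ 2 by rewrite /r2; field.
  by rewrite r13; field.
have h3 : r1 * r2 = a%:R * b%:R.
  have -> : r1 * r2 = r1 ^+ 3 / b%:R by rewrite /r2; field.
  by rewrite r13; field.
pose s3 : R := Num.sqrt 3; have s3E : s3 ^+ 2 = 3 by rewrite sqr_sqrtr.
have s30 : s3 != 0 by rewrite sqrtr_eq0 -ltNge.
pose z : R[i] := Complex (- 2^-1) (s3 / 2).
have hz : z ^+ 2 + z + 1 = 0.
  apply/eqP; rewrite eq_complex /=; apply/andP; split; apply/eqP; last by field.
  rewrite (_ : s3 / 2 * (s3 / 2) = s3 ^+ 2 / 4); last by field.
  by rewrite s3E; field.
have zJ : z ^+ 2 = conjc z.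
  have -> : z ^+ 2 = - z - 1 by apply/eqP; rewrite -subr_eq0 -hz; apply/eqP; ring.
  by apply/eqP; rewrite eq_complex /=; apply/andP; split; apply/eqP; field.
pose c (x : R) : R[i] := real_complex R x.
have cnat n : c n%:R = n%:R by rewrite /c rmorph_nat.
have [f [g [_ [[f1 f2] [g1 g2] _]]]] : exists phi psi chi : {rmorphism K -> R[i]},
    [/\ phi al = c r1 /\ phi be = c r2, psi al = z * c r1 /\ psi be = z ^+ 2 * c r2 &
        chi al = z ^+ 2 * c r1 /\ chi be = z * c r2].
  apply: (pure_pair_rmorph3 pab) => //.
  - by rewrite -cnat -!rmorphM h1.
  - by rewrite -cnat -!rmorphM h2.
  - by have := congr1 c h3; rewrite /c !rmorphM !rmorph_nat.
(* Defined as a conjugate, so that the last clause of [cubic_embeddings] holds by computation; [hal]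
   shows that it is the third embedding. *)
pose h : {rmorphism K -> R[i]} := conjc \o g.
have hal : h al = z ^+ 2 * c r1.
  have -> : h al = conjc z * conjc (c r1) by rewrite -rmorphM -g1.
  by rewrite -zJ conjc_real.
exists r1, r2, f, g, h; split=> //; split.
- apply/seteqP; split=> k; last first.
    by move=> [[]|] ->; [exists f|exists g|exists h].
  move=> [phi ->].
  have : (phi al - c r1) * (phi al - z * c r1) * (phi al - z ^+ 2 * c r1) = 0.
    have p3 : phi al ^+ 3 = c r1 ^+ 3.
      rewrite -rmorphXn (pure_al3 pab) rmorph_int -rmorphXn r13 /pure_radicand.
      transitivity (a%:R * b%:R ^+ 2 : R[i]); first by rewrite rmorphM rmorphXn.
      by rewrite -!cnat /c -rmorphXn -rmorphM.
    transitivity (phi al ^+ 3 - c r1 ^+ 3 - (z ^+ 2 + z + 1) *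
       (phi al ^+ 2 * c r1 - z * phi al * c r1 ^+ 2 + (z - 1) * c r1 ^+ 3)).
      by ring.
    by rewrite p3 hz subrr mul0r subr0.
  move=> /eqP; rewrite !mulf_eq0 !subr_eq0 -!orbA => /or3P[]/eqP e.
  - by left; left; apply: pure_rmorph_ext; rewrite e f1.
  - by left; right; apply: pure_rmorph_ext; rewrite e g1.
  - by right; apply: pure_rmorph_ext; rewrite e hal.
- move=> x; have [x0 [x1 [x2 ->]]] := (pp_basis pab).1 x.
  rewrite rmorph_comb3 f1 f2.
  have rr q : (ratr q : R[i]) = c (ratr q).
    by rewrite -(fmorph_eq_rat (real_complex R \o ratr)).
  by rewrite !rr -!rmorphM -!rmorphD.
- exists al; rewrite g1 /= mulr0 add0r mulf_neq0// ?gt_eqF//.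
  by rewrite divr_gt0// lt0r s30 sqrtr_ge0.
- by [].
Qed.

(** [perp] triples the coordinates, whence 27 = 3 times 3^2 in 3 f(w)^2. The cross term 54 rho1 rho2
    X Y cancels against Tr(w^2) = 54 a b X Y. *)
Lemma pure_minkowski (rho1 rho2 : R) (f g h : {rmorphism K -> R[i]})
    (n u v n' u' v' x y : int) :
  rho1 * rho2 = a%:R * b%:R ->
  f al = Complex rho1 0 -> f be = Complex rho2 0 -> cubic_embeddings f g h ->
  @minkowski_form R K (comb3 al be n%:~R u%:~R v%:~R) (comb3 al be n'%:~R u'%:~R v'%:~R) x y
  = 27 * rho1 ^+ 2 * (u * x + u' * y)%:~R ^+ 2 + 27 * rho2 ^+ 2 * (v * x + v' * y)%:~R ^+ 2.
Proof.
move=> r12 fal fbe ce.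
rewrite (minkowski_formE (basis3_dim (pp_basis pab)) ce) !(pure_perp pab).
set X := u * x + u' * y; set Y := v * x + v' * y.
have -> : comb3 al be 0 (3 * u%:~R) (3 * v%:~R) *~ x + comb3 al be 0 (3 * u'%:~R) (3 * v'%:~R) *~ y
   = comb3 al be 0 (3 * X%:~R) (3 * Y%:~R).
  by rewrite !comb3_mulrz comb3D; congr comb3; rewrite ?/X ?/Y ?rmorphD ?rmorphM /=; ring.
clearbody X Y; rewrite [comb3 _ _ _ _ _ ^+ 2]expr2 (comb3M pab) (pure_field_trace pab) rmorph_comb3 fal fbe.
have -> : complex.Re (ratr 0 + ratr (3 * X%:~R) * Complex rho1 0 + ratr (3 * Y%:~R) * Complex rho2 0)
   = 3 * (X%:~R * rho1 + Y%:~R * rho2).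
  have e3 : (3 : R[i]) = Complex 3 0 by rewrite -[RHS]/(real_complex R 3) rmorph_nat.
  have eI (k : int) : (k%:~R : R[i]) = Complex k%:~R 0.
    by rewrite -[RHS]/(real_complex R _) rmorph_int.
  by rewrite rmorph0 !rmorphM /= !rmorph_nat !ratr_int add0r e3 !eI /=; ring.
rewrite !(rmorphM, rmorphD) /= !rmorph_nat rmorph0 !ratr_int.
transitivity (27 * rho1 ^+ 2 * X%:~R ^+ 2 + 27 * rho2 ^+ 2 * Y%:~R ^+ 2 +
   54 * (rho1 * rho2 - a%:R * b%:R) * X%:~R * Y%:~R); first by ring.
by rewrite r12; ring.
Qed.

End PureShape.

(** The root i sqrt(B / A) already lies in the domain when A <= B; this makes [xget] return a point
    of [shape_points]. *)
Lemma shape_points_diagonal (R : realType) (K : fieldExtType rat) (a1 a2 : K) (A B : R) :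
  is_integral_basis a1 a2 -> 0 < A -> A <= B ->
  (forall x y : int, @minkowski_form R K a1 a2 x y = A * x%:~R ^+ 2 + B * y%:~R ^+ 2) ->
  exists z, @shape_points R K z.
Proof.
move=> ib A0 AB M; have B0 : 0 < B by lra.
have S2 : Num.sqrt (4 * A * B - 0 ^+ 2) ^+ 2 = 4 * A * B.
  by rewrite sqr_sqrtr expr0n /= subr0// !mulr_ge0// ltW.
exists (form_root A 0 B); split.
  rewrite /gauss_domain /form_root /= mul0r; split.
  - rewrite divr_gt0 ?mulr_gt0// sqrtr_gt0 expr0n /= subr0 !mulr_gt0//.
  - by rewrite lexx /= invr_ge0 ler0n.
  - rewrite expr0n /= add0r expr_div_n.
    rewrite [X in X / _](_ : _ = 4 * A * B); last by rewrite -[RHS]S2 expr0n.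
    by rewrite ler_pdivlMr ?exprn_gt0 ?mulr_gt0//; nra.
exists a1, a2, A, 0, B; split=> //.
  by move=> x y; rewrite M; ring.
exists 1%:M; first exact: unitmx1.
by rewrite /GL2Z_act det1 eqxx !mxE /= !mul1r !addr0 mul0r add0r divr1.
Qed.

Lemma wild_pure_shape (R : realType) (K : fieldExtType rat) :
  is_wild_pure_cubic K ->
  is_complex_cubic R K /\ boundary (@gauss_domain R) (@field_shape R K).
Proof.
move=> [/pure_pair_exists[a [b [al [be pab]]]] wild].
have bas := pp_basis pab; have dimK := basis3_dim bas.
have [rho1 [rho2 [f [g [h [[r10 r20] r12 fal fbe ce]]]]]] := pure_cubic_embeddings R pab.
split; first exact: embeddings_complex_cubic dimK ce.
have typ : (3 %| a * b)%N \/
    ~ (exists k, pure_radicand a b - pure_radicand a b ^+ 3 = 9 * k).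
  have [|nab] := boolP (3 %| a * b)%N; first by left.
  right=> nine; move: nab; rewrite Euclid_dvdM// negb_or => /andP[/negP na /negP nb].
  exact: (wild_not_tame pab na nb (nine_div_fourth na nb nine)) wild.
have OS x := wild_integers pab (x := x) typ.
have combz (c0 c1 c2 : int) : c0%:~R + al *~ c1 + be *~ c2 =
    comb3 al be c0%:~R c1%:~R c2%:~R.
  by rewrite comb3_ratint !mulrzl.
have ib : is_integral_basis al be.
  split=> [x|c0 c1 c2].
    split=> [/OS[y0 [y1 [y2 ->]]]|[c0 [c1 [c2 ->]]]].
      by exists y0, y1, y2; rewrite combz.
    by rewrite combz; exact: (integral_comb3_int pab).
  by rewrite combz => /bas.2[/eqP + /eqP + /eqP]; rewrite !intr_eq0 => /eqP-> /eqP-> /eqP->.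
have ib' : is_integral_basis be al.
  have [gen fr] := ib; split=> [x|c0 c1 c2].
    by rewrite gen; split=> -[c0 [c1 [c2 ->]]]; exists c0, c2, c1; rewrite addrAC.
  by rewrite addrAC => /fr[].
have alE : al = comb3 al be 0%:~R 1%:~R 0%:~R by rewrite -combz mulr1z mulr0z; ring.
have beE : be = comb3 al be 0%:~R 0%:~R 1%:~R by rewrite -combz mulr1z mulr0z; ring.
pose A := 27 * rho1 ^+ 2; pose B := 27 * rho2 ^+ 2.
have A0 : 0 < A by rewrite mulr_gt0// exprn_gt0.
have B0 : 0 < B by rewrite mulr_gt0// exprn_gt0.
have shape_ex : exists z, @shape_points R K z.
  have [AB|BA] := leP A B.
    apply: (shape_points_diagonal ib A0 AB) => x y.
    have := pure_minkowski pab 0 1 0 0 0 1 x y r12 fal fbe ce; rewrite -alE -beE => ->.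
    by rewrite !mul1r !mul0r addr0 add0r.
  apply: (shape_points_diagonal ib' B0 (ltW BA)) => x y.
  have := pure_minkowski pab 0 0 1 0 1 0 x y r12 fal fbe ce; rewrite -alE -beE => ->.
  by rewrite !mul1r !mul0r addr0 add0r addrC.
have sz : @shape_points R K (@field_shape R K) by exact: xgetPex.
set z := field_shape R K in sz *.
have gz : gauss_domain z by case: sz.
have [a1 [a2 [ia [r r0 M]]]] := shape_reduced dimK ce sz.
apply: gauss_domain_boundary => //.
have [_ /andP[x0 x2] n1] := gz.
have [e|x0'] := eqVneq (complex.Re z) 0; first by constructor 1.
have [e|x2'] := eqVneq (complex.Re z) 2^-1; first by constructor 2.
have [e|n1'] := eqVneq (complex.Re z ^+ 2 + complex.Im z ^+ 2) 1; first by constructor 3.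
exfalso.
have [gen _] := ia.
have Oa1 : ring_of_integers a1 by apply/gen; exists 0, 1, 0; rewrite mulr1z !mulr0z; ring.
have Oa2 : ring_of_integers a2 by apply/gen; exists 0, 0, 1; rewrite mulr1z !mulr0z; ring.
have [n [u [v ea1]]] := OS _ Oa1; have [n' [u' [v' ea2]]] := OS _ Oa2.
(* The coordinates of al and be in the reduced basis provide the inverse matrix that
   [reduced_diagonal] asks for. *)
have [k [p [q ep]]] := (gen al).1 (integral_al pab).
have [k' [p' [q' ep']]] := (gen be).1 (integral_al (pure_pairC pab)).
have comb (c0 c1 c2 : int) : c0%:~R + a1 *~ c1 + a2 *~ c2 =
    comb3 al be (c0 + n * c1 + n' * c2)%:~R (c1 * u + c2 * u')%:~R (c1 * v + c2 * v')%:~R.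
  rewrite ea1 ea2 !comb3_mulrz.
  have [_ _ cu] := comb3_unit al be.
  have -> : (c0%:~R : K) = comb3 al be c0%:~R 0 0 by rewrite -cu [RHS]rmorph_int.
  rewrite !comb3D !(rmorphD, rmorphM) /=.
  by congr comb3; ring.
rewrite comb in ep; rewrite comb in ep'.
have intE (i j : int) : i%:~R = j%:~R :> rat -> i = j by move=> /eqP; rewrite eqr_int => /eqP.
have [_ /intE e1 /intE e2] := comb3_inj bas (etrans (esym alE) ep).
have [_ /intE e3 /intE e4] := comb3_inj bas (etrans (esym beE) ep').
have xz : 0 < complex.Re z by rewrite lt_neqAle eq_sym x0' x0.
have xz2 : complex.Re z < 2^-1 by rewrite lt_neqAle x2' x2.
have nz : 1 < complex.Re z ^+ 2 + complex.Im z ^+ 2 by rewrite lt_neqAle eq_sym n1' n1.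
apply: (@reduced_diagonal R A B r (r * (2 * complex.Re z))
   (r * (complex.Re z ^+ 2 + complex.Im z ^+ 2)) u v u' v' p q p' q') => //.
- by rewrite !mulr_gt0//= -[X in _ < X]mulr1 ltr_pM2l//; lra.
- by rewrite -[X in X < _]mulr1 ltr_pM2l.
- move=> x y.
  rewrite -(pure_minkowski pab n u v n' u' v' x y r12 fal fbe ce) -ea1 -ea2 M.
  by ring.
Qed.

(** * Fields with shape on the boundary *)

Section BoundaryShape.
Variables (R : realType) (K : fieldExtType rat) (f g h : {rmorphism K -> R[i]}).
Hypothesis dimK : \dim {:K} = 3%N.
Hypothesis ce : cubic_embeddings f g h.
Local Notation tr := (@field_trace K).

Lemma cubic_real x : f x = real_complex R (complex.Re (f x)).
Proof. by have [_ + _ _] := ce => /(_ x); case: (f x) => u v /= ->. Qed.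

Lemma cubic_rational (x : K) (q : rat) : complex.Re (f x) = ratr q -> x = q%:A.
Proof.
move=> e; apply: (fmorph_inj f); rewrite cubic_real e.
rewrite rmorphZ_rat rmorph1 mulr1.
by rewrite -(fmorph_eq_rat (real_complex R \o ratr)).
Qed.

Lemma cubic_ReM x y : complex.Re (f (x * y)) = complex.Re (f x) * complex.Re (f y).
Proof. by rewrite rmorphM [f x]cubic_real [f y]cubic_real /= mulr0 subr0. Qed.

Lemma cubic_ReD x y : complex.Re (f (x + y)) = complex.Re (f x) + complex.Re (f y).
Proof. by rewrite rmorphD; case: (f x) (f y) => ? ? []. Qed.

Lemma cubic_ReB x y : complex.Re (f (x - y)) = complex.Re (f x) - complex.Re (f y).
Proof. by rewrite rmorphB; case: (f x) (f y) => ? ? []. Qed.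

(* The form is 3 f(w)^2 - Tr(w^2), so its polarization at (x, y) vanishes iff
   f(x y) is rational. *)
Lemma rational_product (x y : K) :
  3 * complex.Re (f (x + y)) ^+ 2 - ratr (tr ((x + y) ^+ 2)) =
  3 * complex.Re (f (x - y)) ^+ 2 - ratr (tr ((x - y) ^+ 2)) ->
  exists q : rat, x * y = q%:A.
Proof.
rewrite cubic_ReD cubic_ReB.
have -> : (x + y) ^+ 2 = (x - y) ^+ 2 + 4%:Q *: (x * y).
  by rewrite scaler_int -mulrzr; ring.
rewrite (field_traceD dimK ce) (field_traceZ dimK ce) rmorphD rmorphM /= ratr_int.
set c := ratr _; set d := ratr _ => e.
exists (tr (x * y) / 3); apply: cubic_rational; rewrite cubic_ReM rmorphM /= -/d.
rewrite fmorphV rmorph_nat; lra.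
Qed.

(** The conjugates of y are q / A, q / B, q / C, so Tr y = 0 says that A B + A C + B C = 0. With A +
    B + C = 0, the characteristic polynomial of x is X^3 - A B C. *)
Lemma pure_of_rational_product (x y : K) (q : rat) :
  x != 0 -> y != 0 -> tr x = 0 -> tr y = 0 -> x * y = q%:A -> is_pure_cubic K.
Proof.
move=> x0 y0 tx ty xy.
have := cubic_trace dimK ce x; have := cubic_trace dimK ce y.
have := cubic_trace dimK ce (x ^+ 3); rewrite tx ty rmorph0 !rmorphXn /=.
set A := f x; set B := g x; set C := h x => t3 e1 e2.
have [A0 B0 C0] : [/\ A != 0, B != 0 & C != 0] by rewrite !fmorph_eq0.
have mulq (k : {rmorphism K -> R[i]}) : k x * k y = ratr q.
  by rewrite -rmorphM xy rmorphZ_rat rmorph1 mulr1.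
have q0 : (ratr q : R[i]) != 0 by rewrite -(mulq f) mulf_neq0// fmorph_eq0.
have e3 : B * C + A * C + A * B = 0.
  apply: (mulfI q0); rewrite mulr0.
  transitivity (A * B * C * (f y + g y + h y)); last by rewrite -e1 mulr0.
  transitivity (B * C * (A * f y) + A * C * (B * g y) + A * B * (C * h y)); last by ring.
  by rewrite !mulq; ring.
have cube (X : R[i]) : (X - A) * (X - B) * (X - C) = 0 -> X ^+ 3 = A * B * C.
  move=> hX; transitivity ((X - A) * (X - B) * (X - C) + X ^+ 2 * (A + B + C)
     - X * (B * C + A * C + A * B) + A * B * C); first by ring.
  by rewrite hX -e2 e3; ring.
have cA : A ^+ 3 = A * B * C by apply: cube; rewrite subrr; ring.
have cB : B ^+ 3 = A * B * C by apply: cube; rewrite subrr; ring.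
have cC : C ^+ 3 = A * B * C by apply: cube; rewrite subrr; ring.
pose n : rat := tr (x ^+ 3) / 3.
have x3 : x ^+ 3 = n%:A.
  apply: (fmorph_inj f); rewrite rmorphXn rmorphZ_rat rmorph1 mulr1 /n rmorphM fmorphV /=.
  by rewrite t3 cB cC -cA rmorph_nat; field.
have notrat (c : rat) : x <> c%:A.
  move=> ex; move: tx; rewrite ex (field_trace_alg dimK ce) => /eqP.
  rewrite mulf_eq0 /= => /eqP c0; move: x0; rewrite ex c0 scale0r eqxx //.
exists n; split.
  move=> c ec; apply: (notrat c); apply: cubic_rational.
  set X := complex.Re (f x); set Y : R := ratr c.
  have e : X ^+ 3 = Y ^+ 3.
    have : f (x ^+ 3) = real_complex R (Y ^+ 3).
      rewrite x3 rmorphZ_rat rmorph1 mulr1 -ec rmorphXn [RHS]rmorphXn /=.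
      by rewrite -(fmorph_eq_rat (real_complex R \o ratr)).
    by rewrite rmorphXn [f x]cubic_real -rmorphXn => -[].
  have X0 : X != 0.
    by apply: contraNneq A0 => X0; rewrite /A [f x]cubic_real -/X X0.
  (* Real cube roots are unique: the quadratic factor is positive for X != 0. So x would be
     rational, but a nonzero rational has nonzero trace. *)
  have : (X - Y) * (X ^+ 2 + X * Y + Y ^+ 2) = 0.
    by transitivity (X ^+ 3 - Y ^+ 3); [ring|rewrite e subrr].
  move=> /eqP; rewrite mulf_eq0 subr_eq0 => /orP[/eqP//|/eqP s0].
  have : 0 < X ^+ 2 by rewrite exprn_even_gt0.
  by nra.
exists x; split=> //.
apply/eqP; rewrite eqEdim subvf /= dimK.
have dvd : (\dim <<1; x>> %| 3)%N by rewrite -dimK; apply: field_dimS; exact: subvf.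
have : (\dim <<1; x>> != 1)%N.
  apply/negP => /eqP d1; have : x \in 1%VS.
    have -> : 1%VS = <<1; x>>%VS :> {vspace K}.
      apply/eqP; rewrite eqEdim d1 dimv1 leqnn andbT.
      exact: (subv_adjoin 1%AS x).
    exact: (memv_adjoin 1%AS x).
  by move=> /vlineP[c]; apply: notrat.
by move: dvd; rewrite dvdn_divisors// !inE => /orP[/eqP->//|/eqP->].
Qed.

(** The multiple 2 in the last clause clears the index of the orthogonal pair; k1, l1, k2, l2 below
    are the entries of twice the inverse matrix. *)
Lemma boundary_pair (z : R[i]) : @shape_points R K z -> boundary (@gauss_domain R) z ->
  exists c1 c2 : K, [/\ ring_of_integers c1 /\ ring_of_integers c2,
    perp c1 != 0 /\ perp c2 != 0, exists q : rat, perp c1 * perp c2 = q%:A &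
    forall x, ring_of_integers x -> exists i j : int, perp x *~ 2 = perp c1 *~ i + perp c2 *~ j].
Proof.
move=> sz bz; have gz : gauss_domain z by case: sz.
have [a1 [a2 [[gen fr] [r r0 M]]]] := shape_reduced dimK ce sz.
have [y0 _ _] := gz.
have Oa (i j : int) : ring_of_integers (a1 *~ i + a2 *~ j).
  by apply/gen; exists 0, i, j; rewrite add0r.
have pE (i j : int) : perp (a1 *~ i + a2 *~ j) = perp a1 *~ i + perp a2 *~ j.
  by rewrite (perpD dimK ce) !(perpZint dimK ce).
have pnz (i j : int) : (i != 0) || (j != 0) -> perp (a1 *~ i + a2 *~ j) != 0.
  move=> ij; apply/negP => /eqP p0.
  have := M i j; rewrite (minkowski_formE dimK ce) -pE p0 rmorph0 !expr0n /=.
  have -> : tr 0 = 0 by rewrite -(scale0r (0 : K)) (field_traceZ dimK ce) mul0r.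
  rewrite mulr0 [ratr 0]rmorph0 subrr.
  set X := complex.Re z; set Y := complex.Im z in y0 *.
  have -> : i%:~R ^+ 2 + 2 * X * i%:~R * j%:~R + (X ^+ 2 + Y ^+ 2) * j%:~R ^+ 2 =
     (i%:~R + X * j%:~R) ^+ 2 + (Y * j%:~R) ^+ 2 by ring.
  move=> /esym/eqP; rewrite mulf_eq0 gt_eqF//= paddr_eq0 ?sqr_ge0// !sqrf_eq0.
  rewrite mulf_eq0 (gt_eqF y0) /= intr_eq0 => /andP[+ /eqP j0].
  by rewrite j0 mulr0 addr0 intr_eq0 => i0; move: ij; rewrite i0 j0 eqxx.
pose w (i j : int) : K := a1 *~ i + a2 *~ j.
have half (i1 j1 i2 j2 : int) :
    ((i1 != 0) || (j1 != 0)) && ((i2 != 0) || (j2 != 0)) ->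
    @minkowski_form R K a1 a2 (i1 + i2) (j1 + j2) = @minkowski_form R K a1 a2 (i1 - i2) (j1 - j2) ->
    (exists k1 l1 k2 l2 : int, [/\ k1 * i1 + l1 * i2 = 2, k1 * j1 + l1 * j2 = 0,
       k2 * i1 + l2 * i2 = 0 & k2 * j1 + l2 * j2 = 2]) ->
    exists c1 c2 : K, [/\ ring_of_integers c1 /\ ring_of_integers c2,
    perp c1 != 0 /\ perp c2 != 0, exists q : rat, perp c1 * perp c2 = q%:A &
    forall x, ring_of_integers x -> exists i j : int, perp x *~ 2 = perp c1 *~ i + perp c2 *~ j].
  move=> /andP[n1 n2] Meq [k1 [l1 [k2 [l2 [E1 E2 E3 E4]]]]].
  exists (w i1 j1), (w i2 j2); split; [by split; exact: Oa|by split; exact: pnz| |].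
    apply: rational_product; move: Meq; rewrite !(minkowski_formE dimK ce) -!pE.
    rewrite -(perpD dimK ce) (_ : w i1 j1 + w i2 j2 = w (i1 + i2) (j1 + j2)); last first.
      by rewrite /w !mulrzDr addrACA.
    suff -> : perp (w i1 j1) - perp (w i2 j2) = perp (w (i1 - i2) (j1 - j2)) by [].
    by rewrite !pE !mulrzBr opprD addrACA.
  move=> x /gen[c0 [d1 [d2 ->]]].
  exists (d1 * k1 + d2 * k2), (d1 * l1 + d2 * l2).
  rewrite -addrA (perpD dimK ce).
  have -> : perp (c0%:~R : K) = 0.
    rewrite /perp.
    have -> : (c0%:~R : K) = c0%:Q%:A by rewrite scaler_int.
    rewrite (field_trace_alg dimK ce) -![_%:A]/(in_alg K _) rmorphM rmorph_nat.
    by rewrite subrr.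
  rewrite add0r !pE mulrzDl -!mulrzA mulrz_comb.
  congr (_ *~ _ + _ *~ _).
    transitivity (d1 * (k1 * i1 + l1 * i2) + d2 * (k2 * i1 + l2 * i2)); last by ring.
    by rewrite E1 E3; ring.
  transitivity (d1 * (k1 * j1 + l1 * j2) + d2 * (k2 * j1 + l2 * j2)); last by ring.
  by rewrite E2 E4; ring.
have [X0|X2|n1] := boundary_cases gz bz.
- apply: (half 1 0 0 1) => //; first by rewrite !M X0; ring.
  by exists 2, 0, 0, 2.
- apply: (half (-1) 2 1 0) => //; first by rewrite !M X2; field.
  by exists 0, 2, 1, 1.
- apply: (half 1 1 1 (-1)) => //; first by rewrite !M n1; ring.
  by exists 1, 1, 1, (-1).
Qed.

End BoundaryShape.

(* In the tame case the perps of integers lying on an axis are divisible by 3,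
   while that of the extra integer (1 + m al + (m al)^2) / 3 is not; a pair of
   axis vectors spanning a sublattice of index at most 2 is then impossible. *)
Lemma pure_axis_three (K : fieldExtType rat) a b (al be : K) (y0 y1 y2 : int) :
  pure_pair a b al be -> ~ (3 %| a)%N -> ~ (3 %| b)%N ->
  ring_of_integers (comb3 al be (y0%:~R / 3) (y1%:~R / 3) (y2%:~R / 3)) ->
  y1 = 0 \/ y2 = 0 -> (exists q, y1 = 3 * q) /\ (exists q, y2 = 3 * q).
Proof.
move=> pab na nb /(pure_thirds pab)[[k ek] [l el]] y12.
have na' : ~ exists q, a%:Z = 3 * q by move/three_dvdn_int.
have nb' : ~ exists q, b%:Z = 3 * q by move/three_dvdn_int.
have el3 : y0 ^+ 3 + a%:Z * b%:Z ^+ 2 * y1 ^+ 3 + a%:Z ^+ 2 * b%:Z * y2 ^+ 3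
   - 3 * a%:Z * b%:Z * y0 * y1 * y2 = 3 * (9 * l) by rewrite el; ring.
have [[_ h1 h2]//|[[q0 e0] _ _]] := three_div_norm_coprime na' nb' ek el3.
exfalso; have : y0 ^+ 2 = 3 * k by case: y12 ek => ->; rewrite ?mulr0 ?mul0r subr0.
by lia.
Qed.

(** As a is squarefree and b prime to 3, the radicand m is divisible by 3 exactly once, and so is m
    - m^3. *)
Lemma wild_of_dvd3 (K : fieldExtType rat) a b (al be : K) :
  pure_pair a b al be -> (3 %| a)%N -> wildly_ramified_at_3 K.
Proof.
move=> pab da; have nb := three_coprime pab da.
apply: (wild_of_radicand pab nb) => -[k]; have [a3 ea na3] := three_exact pab da.
rewrite /pure_radicand ea => ek.
have : a3 * b%:Z ^+ 2 = 3 * (k + 3 * a3 ^+ 3 * b%:Z ^+ 6).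
  apply: (mulfI (_ : 3 != 0 :> int)) => //.
  transitivity (3 * a3 * b%:Z ^+ 2 - (3 * a3 * b%:Z ^+ 2) ^+ 3 + 27 * a3 ^+ 3 * b%:Z ^+ 6).
    by ring.
  by rewrite ek; ring.
by case/three_divM => [//|[j /three_divX/three_dvdn_int]].
Qed.

Lemma boundary_shape_wild (R : realType) (K : fieldExtType rat) :
  is_complex_cubic R K -> boundary (@gauss_domain R) (@field_shape R K) ->
  is_wild_pure_cubic K.
Proof.
move=> cc bz; have [dimK _ _] := cc.
have [f [g [h ce]]] := complex_cubic_embeddings cc.
have sz : @shape_points R K (@field_shape R K).
  have [ex|nex] := pselect (exists z, @shape_points R K z); first exact: xgetPex.
  exfalso; apply: (@boundary0 R).
  by move: bz; rewrite /field_shape xgetPN// => z hz; apply: nex; exists z.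
have [c1 [c2 [[I1 I2] [p1 p2] [q pq] span2]]] := boundary_pair dimK ce sz bz.
have pure : is_pure_cubic K.
  exact: (pure_of_rational_product dimK ce p1 p2 (field_trace_perp dimK ce _)
    (field_trace_perp dimK ce _) pq).
split=> //.
have [a [b [al [be pab]]]] := pure_pair_exists pure.
have [da|/negP na] := boolP (3 %| a)%N; first exact: wild_of_dvd3 pab da.
have [db|/negP nb] := boolP (3 %| b)%N; first exact: wild_of_dvd3 (pure_pairC pab) db.
apply: (wild_of_radicand pab nb) => nine.
have bas := pp_basis pab.
have Oh := tame_elt_integral pab (nine_div_fourth na nb nine).
have [y0 [y1 [y2 ec1]]] := integral_thirds pab I1.
have [z0 [z1 [z2 ec2]]] := integral_thirds pab I2.
have perp3 (t0 t1 t2 : int) : perp (comb3 al be (t0%:~R / 3) (t1%:~R / 3) (t2%:~R / 3)) =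
    comb3 al be 0 t1%:~R t2%:~R.
  by rewrite (pure_perp pab); congr comb3; field.
rewrite ec1 in I1; rewrite ec2 in I2; rewrite ec1 ec2 !perp3 in p1 p2 pq span2.
have nz (t1 t2 : int) : comb3 al be 0 t1%:~R t2%:~R != 0 -> (t1 != 0) || (t2 != 0).
  apply: contraNT; rewrite negb_or !negbK => /andP[/eqP-> /eqP->].
  by rewrite /comb3 !rmorph0; apply/eqP; ring.
(* The product of the two vectors has coordinates a y2 z2 on al and b y1 z1 on be, and it is
   rational. As both vectors are nonzero, they lie on the two different axes. *)
have [y1z1 y2z2] : (y1 = 0 \/ z1 = 0) /\ (y2 = 0 \/ z2 = 0).
  have [_ _ cu] := comb3_unit al be.
  move: pq; rewrite (comb3M pab) -[q%:A]/(in_alg K q) cu => /(comb3_inj bas)[_ e1 e2].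
  move: e1 e2; rewrite !mul0r !mulr0 !add0r => /eqP + /eqP.
  rewrite !mulf_eq0 !pnatr_eq0 !eqn0Ngt (pp_a0 pab) (pp_b0 pab) /= !intr_eq0.
  by move=> /orP[]/eqP-> /orP[]/eqP->; split; tauto.
have {}p1 := nz _ _ p1; have {}p2 := nz _ _ p2.
have [yax zax] : (y1 = 0 \/ y2 = 0) /\ (z1 = 0 \/ z2 = 0).
  by move: y1z1 y2z2 p1 p2 => [->|->] [->|->]; rewrite ?eqxx //=; split; auto.
have [[y1' ey1] [y2' ey2]] := pure_axis_three pab na nb I1 yax.
have [[z1' ez1] [z2' ez2]] := pure_axis_three pab na nb I2 zax.
have [i [j]] := span2 _ Oh.
rewrite /tame_elt (pure_perp pab) !comb3_mulrz comb3D => /(comb3_inj bas)[_ e1 _].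
apply: (pure_radicand_not3 na nb).
move: e1; rewrite ey1 ez1; move: (pure_radicand a b) => N e1.
(* The al-coordinate of twice the perp of [tame_elt] is 2 m, while the axis vectors only contribute
   multiples of 3. *)
have : 2 * N = 3 * (i * y1' + j * z1').
  apply/eqP; rewrite -(eqr_int rat); apply/eqP.
  transitivity (2%:~R * (3 * (N%:~R / 3)) : rat); first by rewrite rmorphM /=; field.
  by rewrite e1 !(rmorphM, rmorphD) /=; ring.
move=> /three_divM[[k ek]|//]; exfalso; lia.
Qed.

Theorem theoremF (R : realType) (K : fieldExtType rat) :
  (is_complex_cubic R K /\ boundary (@gauss_domain R) (field_shape R K)) <->
  is_wild_pure_cubic K.
Proof.
split=> [[]|]; first exact: boundary_shape_wild.
exact: wild_pure_shape.
Qed.
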